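(* Let $\alpha$ be a peak composition with $\alpha_i\le 3$ for all $1\le i\le\ell(\alpha)$. Then $$\widetilde{\mathcal S}_\alpha=\sum_{S\subseteq I_\alpha}(-1)^{|S|}\,\widetilde{Q}_{\Delta_S(\alpha)}.$$ In particular, the sum of all coefficients in this expansion is $1$ if $I_\alpha=\emptyset$ and $0$ otherwise.
   Context: A composition $\alpha=(\alpha_1,\dots,\alpha_k)$ of $n$ is a finite list of positive integers with sum $n$; $\ell(\alpha)=k$. The diagram $D(\alpha)$ is the left-justified array with $\alpha_i$ boxes in row $i$, rows numbered from bottom to top; box $(i,j)$ lies in column $i$ and row $j$, and $T_{i,j}$ is the entry of $T$ there. A peak composition is a composition all of whose parts, except possibly the last, are greater than $1$. A filling of $D(\alpha)$ with $1,\dots,n$ satisfies the peak-tableau condition if for every $1\le k\le n$ the boxes with entries $\le k$ form the diagram of a peak composition. For a peak composition $\alpha$ with all parts $\le3$, $I_\alpha:=\{i\mid 1\le i\le\ell(\alpha)-1,\ \alpha_i=3,\ \alpha_{i+1}\ne1\}$. For an interval $[i,j]=\{i,i+1,\dots,j\}\subseteq I_\alpha$, $\Delta_{[i,j]}(\alpha)$ is the composition whose $k$th part is $\alpha_k-1$ if $i\le k\le j$, $\alpha_{j+1}+(j-i+1)$ if $k=j+1$, and $\alpha_k$ otherwise. For $S\subseteq I_\alpha$ written as the disjoint union of its maximal intervals $[i_1,j_1]\cup\cdots\cup[i_s,j_s]$, $\Delta_S(\alpha):=\Delta_{[i_s,j_s]}(\cdots\Delta_{[i_1,j_1]}(\alpha)\cdots)$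 (each $\Delta_{[i,j]}$ given by the same formula applied to the current composition; the order is irrelevant), with $\Delta_\emptyset(\alpha)=\alpha$. SPIT: for a peak composition $\alpha$, $\mathrm{SPIT}(\alpha)$ is the set of fillings of $D(\alpha)$ with $1,\dots,n$ (each once), rows increasing from left to right, first column increasing from bottom to top, satisfying the peak-tableau condition. SYCT: a standard Young composition tableau of shape $\alpha$ is a filling of $D(\alpha)$ with $1,\dots,n$ (each once), rows increasing from left to right, first column increasing from bottom to top, such that whenever $i<j$, $(k,j),(k+1,i)\in D(\alpha)$ and $T_{k,j}\le T_{k+1,i}$, then $(k+1,j)\in D(\alpha)$ and $T_{k+1,j}<T_{k+1,i}$. SPYCT: for a peak composition $\alpha$, $\mathrm{SPYCT}(\alpha)$ is the set of SYCTs of shape $\alpha$ satisfying the peak-tableau condition. Readings: $\mathrm{w}_{\rm c}(T)$ reads column by column starting from the leftmost column, each from bottom to top. $\mathrm{w}_{\rm Y}(T)$ reads the first column from top to bottom, then the subsequent columns from left to right, each from bottom to top. $\mathrm{Des}(\sigma)=\{i\in[n-1]\mid i$ is to the right of $i+1$ in $\sigma\}$; $\mathrm{Peak}(X)=\{i\in X\mid i>1,\ i-1\notin X\}$. For a composition $\gamma$ of $n$, $\mathrm{set}(\gamma)=\{\gamma_1,\gamma_1+\gamma_2,\dots,\gamma_1+\cdots+\gamma_{\ell(\gamma)-1}\}$; for $I=\{i_1<\cdots<i_p\}\subseteq[n-1]$, $\mathrm{comp}(I)=(i_1,i_2-i_1,\dots,n-i_p)$. $F_\gamma=\sum x_{i_1}\cdots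 x_{i_n}$ over $1\le i_1\le\cdots\le i_n$ with $i_j<i_{j+1}$ if $j\in\mathrm{set}(\gamma)$. For a peak composition $\gamma$ of $n$ with $I=\mathrm{set}(\gamma)$, $K_\gamma=2^{|I|+1}\sum F_\beta$ over compositions $\beta$ of $n$ with $I\subseteq\mathrm{set}(\beta)\triangle(\mathrm{set}(\beta)+1)$ ($\triangle$ symmetric difference, $\mathrm{set}(\beta)+1=\{i+1\mid i\in\mathrm{set}(\beta)\}$). Quasisymmetric Schur $Q$-function: $\widetilde{Q}_\alpha=\sum_{T\in\mathrm{SPIT}(\alpha)}K_{\mathrm{comp}(\mathrm{Peak}(\mathrm{Des}(\mathrm{w}_{\rm c}(T))))}$. Peak Young quasisymmetric Schur function: $\widetilde{\mathcal S}_\alpha=\sum_{T\in\mathrm{SPYCT}(\alpha)}K_{\mathrm{comp}(\mathrm{Peak}(\mathrm{Des}(\mathrm{w}_{\rm Y}(T))))}$. *)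

(* Defs.v *)
From mathcomp Require Import all_boot all_order all_algebra finmap multiset.
From mathcomp Require Import boolp classical_sets functions cardinality fsbigop.

Set Implicit Arguments.
Unset Strict Implicit.
Unset Printing Implicit Defensive.

Import GRing.Theory.

Local Open Scope classical_set_scope.
Local Open Scope ring_scope.
Local Open Scope nat_scope.

(* Conventions. A composition is the list of its parts. Rows, columns and     *)
(* parts are numbered from 0, row 0 being the bottom row: the box (i, j) of   *)
(* the mathematical text (column i, row j) is (i - 1, j - 1) here. Tableau    *)
(* entries, descents, peaks and the elements of set(gamma) are unshifted.     *)

Definition is_comp (n : nat) (a : seq nat) : bool :=
  all (leq 1) a && (sumn a == n).

Definition is_peak_comp (a : seq nat) : bool :=
  all (leq 1) a && all (leq 2) (take (size a).-1 a).

Definition diagram (a : seq nat) : set (nat * nat) :=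
  [set b | b.1 < nth 0 a b.2].

Definition cset (g : seq nat) : seq nat :=
  [seq sumn (take k g) | k <- iota 1 (size g).-1].

(* I is the increasing list of the elements of a subset of [n-1]; the case    *)
(* n = 0 is separate because the only composition of 0 is the empty one.      *)
Definition comp_of_set (n : nat) (I : seq nat) : seq nat :=
  if n is 0 then [::] else pairmap (fun a b => b - a) 0 (rcons I n).

(* Formal power series in x_1, x_2, ... with integer coefficients, with       *)
(* pointwise addition: a monomial is the multiset of the indices of its       *)
(* variables, i.e. m k is the exponent of x_k.                                *)
Notation series := ({mset nat}%mset -> int).

(* 1 <= i_1 <= ... <= i_n, where i_j is [nth 0 i j.-1]. *)
Definition Findex (g : seq nat) : set (seq nat) :=
  [set i | [/\ size i = sumn g, path leq 1 i
             & forall j, j \in cset g -> nth 0 i j.-1 < nth 0 i j]].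

(* The formal sum is infinite, but each coefficient is a finite sum. *)
Definition Ffun (g : seq nat) : series :=
  fun m => (\sum_(i \in Findex g) ((m == seq_mset i)%:R : int))%R.

Definition Kindex (g : seq nat) : set (seq nat) :=
  [set b | is_comp (sumn g) b /\
     forall i, i \in cset g -> (i \in cset b) (+) (i \in map succn (cset b))].

Definition Kfun (g : seq nat) : series :=
  ((\sum_(b \in Kindex g) Ffun b) *+ (2 ^ (size (cset g)).+1)%N)%R.

(* A filling is given as the list of its rows, from bottom to top. *)

Definition entry (T : seq (seq nat)) (b : nat * nat) : nat :=
  nth 0 (nth [::] T b.2) b.1.

Definition filling (a : seq nat) (T : seq (seq nat)) : Prop :=
  shape T = a /\ perm_eq (flatten T) (iota 1 (sumn a)).

Definition column (T : seq (seq nat)) (c : nat) : seq nat :=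
  [seq nth 0 r c | r <- T & c < size r].

Definition ncols (T : seq (seq nat)) : nat := \max_(r <- T) size r.

Definition rows_first_col_increasing (T : seq (seq nat)) : Prop :=
  all (sorted ltn) T /\ sorted ltn (column T 0).

Definition peak_tableau (a : seq nat) (T : seq (seq nat)) : Prop :=
  forall k, 1 <= k <= sumn a ->
    exists2 b : seq nat, is_peak_comp b
      & [set x | diagram a x /\ entry T x <= k] = diagram b.

Definition SPIT (a : seq nat) : set (seq (seq nat)) :=
  [set T | [/\ filling a T, rows_first_col_increasing T & peak_tableau a T]].

Definition young_triple (a : seq nat) (T : seq (seq nat)) : Prop :=
  forall i j k, i < j -> diagram a (k, j) -> diagram a (k.+1, i) ->
    entry T (k, j) <= entry T (k.+1, i) ->
    diagram a (k.+1, j) /\ entry T (k.+1, j) < entry T (k.+1, i).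

Definition SYCT (a : seq nat) : set (seq (seq nat)) :=
  [set T | [/\ filling a T, rows_first_col_increasing T & young_triple a T]].

Definition SPYCT (a : seq nat) : set (seq (seq nat)) :=
  [set T | SYCT a T /\ peak_tableau a T].

Definition wc (T : seq (seq nat)) : seq nat :=
  flatten [seq column T c | c <- iota 0 (ncols T)].

Definition wY (T : seq (seq nat)) : seq nat :=
  rev (column T 0) ++ flatten [seq column T c | c <- iota 1 (ncols T).-1].

Definition Des (s : seq nat) : seq nat :=
  [seq i <- iota 1 (size s).-1 | index i.+1 s < index i s].

Definition Peak (X : seq nat) : seq nat :=
  [seq i <- X | (1 < i) && (i.-1 \notin X)].

Definition Qtilde (a : seq nat) : series :=
  (\sum_(T \in SPIT a) Kfun (comp_of_set (sumn a) (Peak (Des (wc T)))))%R.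

Definition Stilde (a : seq nat) : series :=
  (\sum_(T \in SPYCT a) Kfun (comp_of_set (sumn a) (Peak (Des (wY T)))))%R.

Definition Iset (a : seq nat) : {set 'I_(size a)} :=
  [set i : 'I_(size a) |
    [&& i.+1 < size a, nth 0 a i == 3 & nth 0 a i.+1 != 1]].

Definition Delta_itv (i j : nat) (g : seq nat) : seq nat :=
  mkseq (fun k => if i <= k <= j then (nth 0 g k).-1
                  else if k == j.+1 then nth 0 g k + (j - i).+1
                  else nth 0 g k) (size g).

Definition itv l (i j : 'I_l) : {set 'I_l} := [set k : 'I_l | i <= k <= j].

Definition max_itv l (S : {set 'I_l}) (i j : 'I_l) : bool :=
  [&& i <= j, itv i j \subset S &
    [forall i' : 'I_l, forall j' : 'I_l,
      [&& i' <= i, j <= j' & itv i' j' \subset S] ==> (i' == i) && (j' == j)]].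

Definition Delta (a : seq nat) (S : {set 'I_(size a)}) : seq nat :=
  foldl (fun g p => Delta_itv (nat_of_ord p.1) (nat_of_ord p.2) g) a
    (enum [pred p : 'I_(size a) * 'I_(size a) | max_itv S p.1 p.2]).

(* Main.v *)
Require Import Defs.
From mathcomp Require Import all_boot all_order all_algebra functions.
From mathcomp Require Import boolp zify.
From mathcomp Require classical_sets fsbigop.

(* All the sums are rewritten as sums over lists of boxes in the order of their
   entries. Write a_r < b_r < c_r for the entries of row r of a tableau of shape
   alpha. The peak condition forces b_r < a_(r+1), so that only the positions of
   the c_r vary, and it prevents consecutive entries from lying both in column 1,
   so that w_c and w_Y have the same descents.

   The boxes that Delta_S adds to row j+1 are, read from the left, the old boxes
   c_j, c_(j-1), ..., c_i of the interval [i, j]. Moving them back identifies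
   SPIT(Delta_S alpha) with the tableaux in SPIT(alpha) in which, for every i in
   S, c_i exceeds the last entry of row i+1; as descent sets of linear extensions
   depend on the labelling only through the weak or strict nature of each
   relation, the descents may be computed with column 3 read from top to bottom.
   Inclusion-exclusion then leaves the tableaux in which, for every i in I_alpha,
   c_i is smaller than the last entry of row i+1; this means that the c_r increase
   with r and that c_i < b_j whenever i < j and row j has length 2.

   These tableaux and the Young tableaux are both determined by the word giving
   the column of each entry, with the same admissible words: exchanging two
   third-column entries increases or decreases sum_r r c_r until one or the other
   normal form is reached. In both families the descent set is the same function
   of the word, since two consecutive entries of column 3 always form a descent. *)

Set Implicit Arguments.
Unset Strict Implicit.
Unset Printing Implicit Defensive.

Import GRing.Theory.

(** * Sequences *)

Lemma perm_map_ex (T U : eqType) (x0 : T) (f : T -> U) s t :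
  perm_eq t (map f s) -> exists2 s', perm_eq s' s & t = map f s'.
Proof.
move/(perm_iotaP (f x0)) => [Is pIs ->]; rewrite size_map in pIs.
exists (map (nth x0 s) Is).
  by rewrite -[X in perm_eq _ X](mkseq_nth x0); apply: perm_map.
rewrite -map_comp; apply/eq_in_map => i; rewrite (perm_mem pIs) mem_iota => /andP[_ i_s] /=.
by rewrite (nth_map x0).
Qed.

Lemma index_map_in (T U : eqType) (f : T -> U) s x :
  {in s &, injective f} -> x \in s -> index (f x) (map f s) = index x s.
Proof.
elim: s => //= y s IH inj; rewrite inE.
have inj' : {in s &, injective f}.
  by move=> u v us vs; apply: inj; rewrite inE ?us ?vs orbT.
case: (eqVneq x y) => [->|xy /= xs]; first by rewrite eqxx.
rewrite ifN ?IH //.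
by apply: contraNneq xy => /inj ->//; rewrite inE ?eqxx ?xs ?orbT.
Qed.

Lemma index_neq (T : eqType) (t : seq T) x y : x \in t -> x != y -> index x t != index y t.
Proof.
move=> xt; apply: contraNneq => e.
by rewrite -(nth_index x xt) e nth_index // -index_mem -e index_mem.
Qed.

Lemma eq_from_index (T : eqType) (t1 t2 : seq T) : uniq t1 -> perm_eq t1 t2 ->
  {in t1, forall x, index x t1 = index x t2} -> t1 = t2.
Proof.
move=> u1 p12 h; case: t1 u1 p12 h => [|x0 s]; first by rewrite perm_sym => _ /perm_nilP.
set t1 := x0 :: s => u1 p12 h.
apply: (@eq_from_nth _ x0); first exact: perm_size.
move=> i it1; have xt1 : nth x0 t1 i \in t1 by rewrite mem_nth.
have := h _ xt1; rewrite index_uniq // => ei.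
by rewrite {2}ei nth_index // -(perm_mem p12).
Qed.

Lemma map_index_id (T : eqType) (t : seq T) : uniq t -> map (index^~ t) t = iota 0 (size t).
Proof.
case: t => // x0 s; set t := x0 :: s => ut; apply: (@eq_from_nth _ 0); rewrite size_map ?size_iota //.
by move=> i it; rewrite (nth_map x0) // index_uniq // nth_iota.
Qed.

Lemma pairwise_index (T : eqType) (k : T -> nat) (s : seq T) : pairwise (relpre k ltn) s ->
  {in s &, forall x y, (index x s < index y s) = (k x < k y)}.
Proof.
move=> ps; have us : uniq s by apply: pairwise_uniq ps => x; exact: ltnn.
case: s ps us => // x0 s' ps us; set s := x0 :: s'.
have h x y : x \in s -> y \in s -> index x s < index y s -> k x < k y.
  move=> xs ys lt; have /(pairwiseP x0) := ps.
  by move/(_ (index x s) (index y s)); rewrite !inE !index_mem !nth_index //; apply.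
move=> x y xs ys; apply/idP/idP; first exact: h.
move=> kxy; rewrite ltnNge leq_eqVlt; apply/negP => /predU1P[e|/h-/(_ ys xs)]; last by lia.
by move: kxy; rewrite -[x](nth_index x0 (s := s)) // -e nth_index ?ltnn.
Qed.

Lemma big_bij (V : nmodType) (I J : eqType) (r1 : seq I) (r2 : seq J)
    (f : I -> J) (g : J -> I) (F : J -> V) :
    uniq r1 -> uniq r2 ->
    {in r1, forall x, f x \in r2 /\ g (f x) = x} ->
    {in r2, forall y, g y \in r1 /\ f (g y) = y} ->
  (\sum_(y <- r2) F y = \sum_(x <- r1) F (f x))%R.
Proof.
move=> u1 u2 fP gP; rewrite -[RHS](big_map f xpredT F); apply: perm_big.
apply: uniq_perm => //.
  rewrite map_inj_in_uniq // => x x' /fP[_ e] /fP[_ e'] eq.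
  by rewrite -e -e' eq.
move=> y; apply/idP/mapP => [/gP[gy e]|[x /fP[fx _] ->//]].
by exists (g y).
Qed.

(** * Descents of linear extensions *)

Section Swap.
Variable T : eqType.
Implicit Types (x y z : T) (s t : seq T).

Definition swap x y z := if z == x then y else if z == y then x else z.

Lemma swapK x y : involutive (swap x y).
Proof.
move=> z; rewrite /swap; case: (eqVneq z x) => [->|zx].
  by rewrite eqxx; case: eqVneq => // ->.
case: (eqVneq z y) => [->|zy]; first by rewrite eqxx.
by rewrite (negPf zx) (negPf zy).
Qed.

Lemma swap_inj x y : injective (swap x y).
Proof. exact: inv_inj (swapK x y). Qed.

Lemma index_map_swap x y z t :
  index z (map (swap x y) t) = index (swap x y z) t.
Proof. by rewrite -{1}(swapK x y z) (index_map (@swap_inj x y)). Qed.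

Lemma mem_swap x y z t : x \in t -> y \in t -> (swap x y z \in t) = (z \in t).
Proof.
by move=> xt yt; rewrite /swap; case: eqVneq => [->|_]; [rewrite xt yt|
  case: eqVneq => [->|//]; rewrite xt yt].
Qed.

Lemma perm_map_swap x y t : uniq t -> x \in t -> y \in t ->
  perm_eq (map (swap x y) t) t.
Proof.
move=> ut xt yt; apply: uniq_perm => //; first by rewrite map_inj_uniq //; exact: swap_inj.
by move=> z; rewrite -{1}(swapK x y z) mem_map ?mem_swap //; exact: swap_inj.
Qed.

(** No position lies strictly between two adjacent ones, so the exchange changes the relative order
    of the pair [x], [y] only. *)
Lemma swap_adjacent x y z1 z2 t : uniq t -> x \in t -> y \in t ->
    z1 \in t -> z2 \in t ->
    index y t = (index x t).+1 \/ index x t = (index y t).+1 ->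
    (z1, z2) != (x, y) -> (z1, z2) != (y, x) ->
  (index (swap x y z1) t < index (swap x y z2) t) = (index z1 t < index z2 t).
Proof.
move=> ut xt yt z1t z2t adj n1 n2.
have ne z w : z \in t -> z != w -> index z t <> index w t.
  by move=> zt /eqP zw e; apply: zw; rewrite -(nth_index w zt) e nth_index // -index_mem -e index_mem.
rewrite !xpair_eqE in n1 n2; rewrite /swap.
case: (eqVneq z1 x) n1 n2 => [->|z1x]; case: (eqVneq z2 x) => [->|z2x] //=; rewrite ?ltnn //.
- case: (eqVneq z2 y) => //= z2y _ _.
  by have := ne z2 x z2t z2x; have := ne z2 y z2t z2y; case: adj; lia.
- case: (eqVneq z1 y) => //= z1y _ _.
  by have := ne z1 x z1t z1x; have := ne z1 y z1t z1y; case: adj; lia.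
- move=> _ _; case: (eqVneq z1 y) => [->|z1y]; case: (eqVneq z2 y) => [->|z2y] //.
  + by rewrite !ltnn.
  + by have := ne z2 x z2t z2x; have := ne z2 y z2t z2y; case: adj; lia.
  + by have := ne z1 x z1t z1x; have := ne z1 y z1t z1y; case: adj; lia.
Qed.

End Swap.

(** * Linear extensions of a relation and their descents for a labelling *)

Section Respect.
Variables (T : eqType) (x0 : T).
Implicit Types (R : rel T) (s t : seq T).

Definition respects R t :=
  all (fun x => all (fun y => R x y ==> (index x t < index y t)) t) t.

Lemma respectsP R t :
  reflect {in t &, forall x y, R x y -> index x t < index y t} (respects R t).
Proof.
apply: (iffP allP) => [h x y xt yt|h x xt].
  by have /allP/(_ y yt)/implyP := h x xt.
by apply/allP => y yt; apply/implyP; apply: h.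
Qed.

(** Entry i stands at position [i.-1] of [t], so i is a descent when the element of entry i+1 has
    the smaller key, that is, is read before that of entry i. *)
Definition des (key : T -> nat) t : seq nat :=
  [seq i <- iota 1 (size t).-1 | key (nth x0 t i) < key (nth x0 t i.-1)].

Definition linexts R s : seq (seq T) := [seq t <- permutations s | respects R t].

Lemma linextsP R s t : (t \in linexts R s) = perm_eq t s && respects R t.
Proof. by rewrite mem_filter mem_permutations andbC. Qed.

Lemma linexts_uniq R s : uniq (linexts R s).
Proof. by rewrite filter_uniq // permutations_uniq. Qed.

Lemma perm_linexts R s1 s2 : perm_eq s1 s2 -> perm_eq (linexts R s1) (linexts R s2).
Proof.
move=> p; apply: uniq_perm; try exact: linexts_uniq.
by move=> t; rewrite !linextsP (permPr p).
Qed.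

Lemma des_in (k1 k2 : T -> nat) t :
  (forall i, 0 < i < size t ->
     (k1 (nth x0 t i) < k1 (nth x0 t i.-1)) = (k2 (nth x0 t i) < k2 (nth x0 t i.-1))) ->
  des k1 t = des k2 t.
Proof.
move=> h; apply: eq_in_filter => i; rewrite mem_iota => /andP[i0 i1].
by apply: h; lia.
Qed.

Variables (V : nmodType) (G : seq nat -> V).

(** Involution: exchange [x] and [y] in the extensions where they are adjacent, keep the other
    extensions. In the first case the exchange in [t] undoes the one in the labelling; in the
    second, the labels of [x] and [y] are consecutive and these two are never neighbours in [t], so
    no comparison of neighbours changes. *)
Lemma linexts_swap R s x y : uniq s -> x \in s -> y \in s ->
    index y s = (index x s).+1 -> ~~ R x y -> ~~ R y x ->
  (\sum_(t <- linexts R s) G (des (index^~ s) t) =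
   \sum_(t <- linexts R s) G (des (index^~ (map (swap x y) s)) t))%R.
Proof.
move=> us xs ys adj Rxy Ryx.
have xy : x != y by apply/eqP => e; move: adj; rewrite e; lia.
pose adjt t := (index y t == (index x t).+1) || (index x t == (index y t).+1).
pose f t := if adjt t then map (swap x y) t else t.
have adjf t : adjt (map (swap x y) t) = adjt t.
  rewrite /adjt !index_map_swap /swap !eqxx.
  by case: (eqVneq y x) => [e|_]; [rewrite e eqxx in xy|rewrite orbC].
have fK t : f (f t) = t.
  rewrite /f; case E: (adjt t); last by rewrite E.
  by rewrite adjf E -map_comp map_id_in // => z _; apply: swapK.
have fP : {in linexts R s, forall t, f t \in linexts R s}.
  move=> t; rewrite !linextsP => /andP[pt Rt]; rewrite /f; case E: (adjt t); last by rewrite pt.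
  have ut : uniq t by rewrite (perm_uniq pt).
  have [xt yt] : x \in t /\ y \in t by rewrite !(perm_mem pt).
  have pst := perm_map_swap ut xt yt.
  rewrite (perm_trans pst) //=; apply/respectsP => z1 z2.
  rewrite !(perm_mem pst) => z1t z2t Rz; rewrite !index_map_swap swap_adjacent //.
  - by move/respectsP: Rt; apply.
  - by case/orP: E => /eqP; [left|right].
  - by apply: contraNneq Rxy => -[<- <-].
  - by apply: contraNneq Ryx => -[<- <-].
rewrite (big_bij (f := f) (g := f) _ (linexts_uniq R s) (linexts_uniq R s)) => [| t ht|t ht].
2,3: by rewrite fK; split=> //; apply: fP.
apply: eq_big_seq => t; rewrite linextsP => /andP[pt Rt]; congr G.
have ut : uniq t by rewrite (perm_uniq pt).
have nts i : i < size t -> nth x0 t i \in s by move=> it; rewrite -(perm_mem pt) mem_nth.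
have iP i : i \in iota 1 (size t).-1 -> [/\ 0 < i, i < size t & i.-1 < size t].
  by rewrite mem_iota => /andP[]; clear; move: (size t) => m; split; lia.
rewrite /f; case E: (adjt t); rewrite /des ?size_map; apply: eq_in_filter => i /iP[i0 it it'].
  by rewrite !(nth_map x0) ?index_map_swap.
have nadj u v : (u, v) = (x, y) \/ (u, v) = (y, x) -> index v t = (index u t).+1 -> False.
  by move=> uv e; move: E; rewrite /adjt; case: uv => -[<- <-]; rewrite e eqxx ?orbT.
have idi : index (nth x0 t i) t = (index (nth x0 t i.-1) t).+1 by rewrite !index_uniq // prednK.
rewrite !index_map_swap swap_adjacent ?nts //; first by left.
- by apply/eqP => -[e1 e2]; apply: (nadj _ _ _ idi); rewrite e1 e2; right.
- by apply/eqP => -[e1 e2]; apply: (nadj _ _ _ idi); rewrite e1 e2; left.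
Qed.

Lemma linexts_swap_cat R p q x y : uniq (p ++ x :: y :: q) -> ~~ R x y -> ~~ R y x ->
  (\sum_(t <- linexts R (p ++ x :: y :: q)) G (des (index^~ (p ++ x :: y :: q)) t) =
   \sum_(t <- linexts R (p ++ y :: x :: q)) G (des (index^~ (p ++ y :: x :: q)) t))%R.
Proof.
move=> us Rxy Ryx; set s := p ++ x :: y :: q; set s' := p ++ y :: x :: q.
have := us; rewrite cat_uniq 2!cons_uniq inE /= !negb_or.
case/and5P=> _ /and3P[xp yp _] /andP[xy xq] yq _.
have ss' : s' = map (swap x y) s.
  have id_out r : x \notin r -> y \notin r -> map (swap x y) r = r.
    move=> xr yr; rewrite map_id_in // => z zr; rewrite /swap.
    by rewrite !ifN //; [apply: contraNneq yr => <-|apply: contraNneq xr => <-].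
  rewrite map_cat /= !id_out // /swap !eqxx.
  by case: eqVneq => [e|//]; rewrite e eqxx in xy.
rewrite (@linexts_swap R s x y) //.
- rewrite -ss'; apply: perm_big; apply: perm_linexts.
  by rewrite perm_cat2l; exact: (permEl (perm_catCA [:: x] [:: y] q)).
- by rewrite mem_cat !inE eqxx orbT.
- by rewrite mem_cat !inE eqxx !orbT.
- rewrite !index_cat (negPf xp) (negPf yp) /= !eqxx.
  by rewrite (negPf xy) addnS addn0.
Qed.

(** [p] holds the elements already in place. The head [x] of [s2] is related by [K] in both
    directions to every element that precedes it in [s1]; it is therefore incomparable with them for
    [R], and adjacent exchanges bring it to the front. *)
Lemma linexts_invariant_cat R K p s1 s2 : perm_eq s1 s2 -> uniq (p ++ s1) ->
    pairwise K s1 -> pairwise K s2 ->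
    (forall x y, K x y -> K y x -> ~~ R x y /\ ~~ R y x) ->
  (\sum_(t <- linexts R (p ++ s1)) G (des (index^~ (p ++ s1)) t) =
   \sum_(t <- linexts R (p ++ s2)) G (des (index^~ (p ++ s2)) t))%R.
Proof.
move=> + + + + KR; elim: s2 p s1 => [|x s2 IH] p s1.
  by move=> /perm_nilP ->.
move=> p12 us K1 /=/andP[Kx K2].
have /splitPr xs1 : x \in s1 by rewrite (perm_mem p12) mem_head.
case: {s1} xs1 p12 us K1 => u v p12 us K1.
have p12' : perm_eq (u ++ v) s2.
  rewrite -(perm_cons x) -(permPr p12) perm_sym perm_catC /= perm_cons.
  by rewrite perm_catC.
move: K1; rewrite pairwise_cat /= => /and3P[/allrelP Kuxv Ku /andP[Kxv Kv]].
have KuR z : z \in u -> ~~ R z x /\ ~~ R x z.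
  move=> zu; apply: KR; first by apply: Kuxv; rewrite ?mem_head.
  by move/allP: Kx; apply; rewrite -(perm_mem p12') mem_cat zu.
have -> : (\sum_(t <- linexts R (p ++ u ++ x :: v)) G (des (index^~ (p ++ u ++ x :: v)) t) =
  \sum_(t <- linexts R (p ++ x :: u ++ v)) G (des (index^~ (p ++ x :: u ++ v)) t))%R.
  clear -us KuR; elim/last_ind: u v us KuR => [//|u z IHu] v us KuR.
  have [Rzx Rxz] : ~~ R z x /\ ~~ R x z by apply: KuR; rewrite mem_rcons mem_head.
  move: us; rewrite !cat_rcons => us.
  rewrite !catA linexts_swap_cat -?catA // IHu // => [|w wu]; last by apply: KuR; rewrite mem_rcons inE wu orbT.
  move: us; congr (is_true _); apply: perm_uniq; rewrite !perm_cat2l.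
  exact: (permEl (perm_catCA [:: z] [:: x] v)).
rewrite -!cat_rcons; apply: IH => //.
  rewrite cat_rcons; move: us; congr (is_true _); apply: perm_uniq.
  by rewrite perm_cat2l perm_catC /= perm_cons perm_catC.
rewrite pairwise_cat Ku Kv andbT; apply/andP; split=> //.
by apply/allrelP => a b au bv; apply: Kuxv; rewrite ?inE ?bv ?orbT.
Qed.

(* The descent statistics of the linear extensions of a labelled poset depend
   on the labelling only through the strict or weak nature of each relation. *)
Lemma linexts_invariant R s (k1 k2 : T -> nat) : uniq s ->
    {in s &, injective k1} -> {in s &, injective k2} ->
    {in s &, forall x y, R x y -> (k1 x < k1 y) = (k2 x < k2 y)} ->
  (\sum_(t <- linexts R s) G (des k1 t) = \sum_(t <- linexts R s) G (des k2 t))%R.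
Proof.
move=> us i1 i2 agree.
(* Descents depend only on the relative order of the keys, so a key may be replaced by the position
   in the list sorted by that key. *)
pose srt k := sort (relpre k leq) s.
have ps k : perm_eq (srt k) s by rewrite perm_sort.
have us' k : uniq (srt k) by rewrite (perm_uniq (ps k)).
have srtd k : sorted (relpre k leq) (srt k) by apply: sort_sorted => x y; apply: leq_total.
have tr (k : T -> nat) : transitive (relpre k leq) by move=> y x z; apply: leq_trans.
have idx k : {in s &, injective k} -> {in s &, forall x y, (index x (srt k) < index y (srt k)) = (k x < k y)}.
  move=> ik; have le x y : x \in s -> y \in s -> index x (srt k) < index y (srt k) -> k x < k y.
    rewrite -!(perm_mem (ps k)) => xs ys lt.
    have /= := sorted_ltn_index (@tr k) (srtd k) x y xs ys lt.
    rewrite leq_eqVlt => /predU1P[e|//]; rewrite !(perm_mem (ps k)) in xs ys.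
    by move: lt; rewrite (ik _ _ xs ys e) ltnn.
  move=> x y xs ys; apply/idP/idP; first exact: le.
  move=> kxy; rewrite ltnNge leq_eqVlt; apply/negP => /predU1P[e|/le-/(_ ys xs)]; last by lia.
  by move: kxy; rewrite -[x](nth_index x0 (s := srt k)) ?(perm_mem (ps k)) // -e nth_index ?ltnn // (perm_mem (ps k)).
have des_srt k : {in s &, injective k} ->
    (\sum_(t <- linexts R s) G (des k t) = \sum_(t <- linexts R (srt k)) G (des (index^~ (srt k)) t))%R.
  move=> ik; rewrite (perm_big _ (perm_linexts R (ps k))); apply: eq_big_seq => t.
  rewrite linextsP => /andP[pt _]; congr G; apply: des_in => i it.
  by rewrite idx // -(perm_mem pt) mem_nth //; lia.
rewrite (des_srt k1 i1) (des_srt k2 i2).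
pose o x y := index x (srt k2) < index y (srt k2).
have agree' x y : x \in s -> y \in s -> R x y -> o x y = (k1 x < k1 y).
  by move=> xs ys Rxy; rewrite /o idx // agree.
have asym x y : o x y -> ~~ o y x by rewrite /o -leqNgt; apply: ltnW.
(* [K x y] says that placing [x] before [y] agrees with the order [o] whenever the two are related
   by [R]. Both sorted lists obey it, and if it holds in both directions then [x] and [y] are
   unrelated. *)
pose K x y := [&& R x y ==> o x y & R y x ==> ~~ o y x].
have pw k : {in s &, injective k} -> {in s &, forall x y, k x < k y -> K x y} -> pairwise K (srt k).
  move=> ik hk; apply/(pairwiseP x0) => i j si sj ij; apply: hk.
  - by rewrite -(perm_mem (ps k)) mem_nth.
  - by rewrite -(perm_mem (ps k)) mem_nth.
  - by rewrite -idx // ?index_uniq // -(perm_mem (ps k)) mem_nth.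
apply: (@linexts_invariant_cat R K [::]); rewrite ?us' //=.
- by rewrite (permPl (ps k1)) perm_sym ps.
- apply: pw => // x y xs ys lt; apply/andP; split; apply/implyP => Rxy; rewrite agree' //.
  by rewrite -leqNgt ltnW.
- apply: pw => // x y xs ys lt; have oxy : o x y by rewrite /o idx.
  by rewrite /K oxy asym // !implybT.
- rewrite /K => x y /andP[h1 h2] /andP[h3 h4]; split; apply/negP => h.
  + by move: (implyP h1 h) (implyP h4 h) => ->.
  + by move: (implyP h3 h) (implyP h2 h) => ->.
Qed.

End Respect.

(** * Boxes and reading orders *)

Notation box := (nat * nat)%type.
Notation box0 := (0, 0).

Definition boxes (b : seq nat) : seq box :=
  [seq (c, r) | r <- iota 0 (size b), c <- iota 0 (nth 0 b r)].

Lemma nth_pos_lt (b : seq nat) r c : c < nth 0 b r -> r < size b.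
Proof. by move=> h; rewrite ltnNge; apply/negP => /(nth_default 0) e; rewrite e in h. Qed.

Lemma mem_boxes b x : (x \in boxes b) = (x.1 < nth 0 b x.2).
Proof.
apply/allpairsPdep/idP => [[r [c []]]|h].
  by rewrite !mem_iota => /= _ h ->.
exists x.2, x.1; rewrite !mem_iota /=; split=> //; last by case: x {h}.
exact: nth_pos_lt h.
Qed.

Lemma boxes_uniq b : uniq (boxes b).
Proof.
apply: allpairs_uniq_dep; first exact: iota_uniq.
  by move=> r _; apply: iota_uniq.
by move=> [r c] [r' c'] _ _ /= [-> ->].
Qed.

Lemma size_boxes b : size (boxes b) = sumn b.
Proof.
rewrite /boxes size_allpairs_dep; congr sumn.
rewrite -[RHS](mkseq_nth 0); apply: eq_map => r; exact: size_iota.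
Qed.

(** The two clauses are the increase along rows and the inequality b_r < a_(r+1), into which the
    peak condition is translated. *)
Definition box_rel : rel box :=
  fun x y => (y == (x.1.+1, x.2)) || (x.1 == 1) && (y == (0, x.2.+1)).

(* [p] selects the columns that are read from top to bottom. *)
Definition read_key (p : pred nat) (N : nat) (x : box) : nat :=
  x.1 * N + (if p x.1 then N.-1 - x.2 else x.2).

Lemma read_keyP p N x y : x.2 < N -> y.2 < N ->
  (read_key p N x < read_key p N y) =
  (x.1 < y.1) || (x.1 == y.1) && (if p x.1 then y.2 < x.2 else x.2 < y.2).
Proof.
case: x y => [c r] [c' r'] /= rN rN'; rewrite /read_key /=.
have [->|ne] := eqVneq c c'; first by case: (p c'); rewrite ltnn; lia.
rewrite orbF.
have : (if p c then N.-1 - r else r) < N by case: (p c); lia.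
have : (if p c' then N.-1 - r' else r') < N by case: (p c'); lia.
move: (if _ then _ else _) (if _ then _ else _) => u v uN vN.
by apply/idP/idP; nia.
Qed.

Lemma read_key_inj p N : {in [pred x : box | x.2 < N] &, injective (read_key p N)}.
Proof.
move=> x y; rewrite !inE => xN yN e.
have := read_keyP p xN yN; have := read_keyP p yN xN; rewrite e ltnn.
case: x y {e xN yN} => [c r] [c' r'] /=.
case: ltngtP => //= <-.
by case: (p c') => /= h1 h2; congr pair; lia.
Qed.

Definition colbox b c : seq box := [seq (c, r) | r <- iota 0 (size b) & c < nth 0 b r].

Definition read_boxes (p : pred nat) b (cs : seq nat) : seq box :=
  flatten [seq (if p c then rev (colbox b c) else colbox b c) | c <- cs].

Lemma mem_colbox b c x : (x \in colbox b c) = (x.1 == c) && (x.1 < nth 0 b x.2).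
Proof.
apply/mapP/andP => [[r]|[/eqP <- h]].
  by rewrite mem_filter => /andP[h _] -> /=.
exists x.2; last by case: x h.
by rewrite mem_filter h mem_iota /= (nth_pos_lt h).
Qed.

Lemma mem_read_boxes p b cs x :
  (x \in read_boxes p b cs) = (x.1 \in cs) && (x.1 < nth 0 b x.2).
Proof.
apply/flatten_mapP/andP => [[c ccs]|[h1 h2]].
  have -> : (x \in (if p c then rev (colbox b c) else colbox b c)) = (x \in colbox b c).
    by case: ifP; rewrite ?mem_rev.
  by rewrite mem_colbox => /andP[/eqP-> ->].
exists x.1 => //; have := mem_colbox b x.1 x; rewrite eqxx h2 /=.
by case: ifP; rewrite ?mem_rev.
Qed.

Lemma read_boxes_pairwise p b cs : sorted ltn cs ->
  pairwise (relpre (read_key p (size b)) ltn) (read_boxes p b cs).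
Proof.
rewrite sorted_pairwise; last exact: ltn_trans.
elim: cs => //= c cs IH /andP[ccs /IH {}IH]; rewrite /read_boxes /= pairwise_cat IH andbT.
apply/andP; split.
  apply/allrelP => x y xc; rewrite mem_read_boxes => /andP[yc yb].
  have {xc} : x \in colbox b c by case: ifP xc; rewrite ?mem_rev.
  rewrite mem_colbox => /andP[/eqP xc xb] /=.
  rewrite read_keyP ?(nth_pos_lt xb) ?(nth_pos_lt yb) //.
  by rewrite xc; move/allP: ccs => /(_ _ yc) /= ->.
have pw : pairwise (fun x y : box => x.2 < y.2) (colbox b c).
  rewrite pairwise_map -sorted_pairwise; last by move=> ? ? ?; apply: ltn_trans.
  by apply: sorted_filter; [move=> ? ? ?; apply: ltn_trans|apply: iota_ltn_sorted].
have al : all [pred x : box | (x.1 == c) && (x.2 < size b)] (colbox b c).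
  by apply/allP => x; rewrite mem_colbox /= => /andP[-> /nth_pos_lt].
case: ifP => pc.
  rewrite -sorted_pairwise; last by move=> ? ? ?; apply: ltn_trans.
  rewrite rev_sorted sorted_pairwise; last by move=> ? ? ? /= h1 h2; apply: ltn_trans h2 h1.
  apply: sub_in_pairwise al pw => x y /andP[/eqP xc xN] /andP[/eqP yc yN] /= h.
  by rewrite read_keyP // xc yc eqxx pc h orbT.
apply: sub_in_pairwise al pw => x y /andP[/eqP xc xN] /andP[/eqP yc yN] /= h.
by rewrite read_keyP // xc yc eqxx pc h orbT.
Qed.

Lemma perm_read_boxes p b cs : sorted ltn cs -> (forall x, x.1 < nth 0 b x.2 -> x.1 \in cs) ->
  perm_eq (read_boxes p b cs) (boxes b).
Proof.
move=> scs h; apply: uniq_perm; last 1 first.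
- by move=> x; rewrite mem_read_boxes mem_boxes andb_idl // => /h.
- apply: pairwise_uniq (read_boxes_pairwise p b scs) => x; exact: ltnn.
- exact: boxes_uniq.
Qed.

(** The mapped list is the reading word: each box of [s] is replaced by its entry. As [s] is sorted
    by [k], being further left in the word means having a smaller key. *)
Lemma Des_index (T : eqType) (x0 : T) (k : T -> nat) (s t : seq T) : uniq t -> perm_eq s t ->
    pairwise (relpre k ltn) s ->
  Des [seq (index x t).+1 | x <- s] = des x0 k t.
Proof.
move=> ut st ps; rewrite /Des /des size_map (perm_size st).
apply: eq_in_filter => i; rewrite mem_iota => /andP[i0 it].
have {}it : i < size t by lia.
have it' : i.-1 < size t by lia.
have idx j : j < size t -> index j.+1 [seq (index x t).+1 | x <- s] = index (nth x0 t j) s.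
  move=> jt; have -> : j.+1 = (index (nth x0 t j) t).+1 by rewrite index_uniq.
  have : nth x0 t j \in s by rewrite (perm_mem st) mem_nth.
  have sub : {subset s <= t} by move=> z; rewrite (perm_mem st).
  elim: s sub {st ps} => //= z s IH sub; rewrite inE eqSS.
  have zt : z \in t by apply: sub; rewrite mem_head.
  have sub' : {subset s <= t} by move=> w ws; apply: sub; rewrite inE ws orbT.
  have -> : (index z t == index (nth x0 t j) t) = (z == nth x0 t j).
    apply/eqP/eqP => [e|->//].
    by rewrite -[z](nth_index x0 zt) e nth_index ?mem_nth.
  by rewrite [nth _ _ _ == z]eq_sym; case: eqP => //= _ /(IH sub') ->.
rewrite idx // -{2}(prednK i0) idx //.
by apply: pairwise_index => //; rewrite (perm_mem st) mem_nth.
Qed.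

(** * Tableaux as lists of boxes *)

Section Tableaux.
Import classical_sets fsbigop.
Local Open Scope classical_set_scope.

(** Encodes a filling by the list [t] of its boxes in the order of their entries: an entry is a
    position in [t] plus one. *)
Definition tab (b : seq nat) (t : seq box) : seq (seq nat) :=
  [seq [seq (index (c, r) t).+1 | c <- iota 0 (nth 0 b r)] | r <- iota 0 (size b)].

Lemma shape_tab b t : shape (tab b t) = b.
Proof.
rewrite /shape /tab -map_comp -[RHS](mkseq_nth 0); apply: eq_map => r /=.
by rewrite size_map size_iota.
Qed.

Lemma flatten_tab b t : flatten (tab b t) = [seq (index x t).+1 | x <- boxes b].
Proof.
rewrite /tab /boxes map_flatten -map_comp; congr flatten; apply: eq_map => r /=.
by rewrite -map_comp.
Qed.

Lemma nth_tab b t r : r < size b ->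
  nth [::] (tab b t) r = [seq (index (c, r) t).+1 | c <- iota 0 (nth 0 b r)].
Proof. by move=> rb; rewrite (nth_map 0) ?size_iota // nth_iota. Qed.

Lemma entry_tab b t x : x.1 < nth 0 b x.2 -> entry (tab b t) x = (index x t).+1.
Proof.
case: x => c r /= h; rewrite /entry /= nth_tab ?(nth_pos_lt h) //.
by rewrite (nth_map 0) ?size_iota // nth_iota.
Qed.

Lemma boxes_filling T : [seq entry T x | x <- boxes (shape T)] = flatten T.
Proof.
rewrite /boxes map_flatten -map_comp -[in RHS](mkseq_nth [::] T) /mkseq size_map; congr flatten.
apply: eq_map => r /=; rewrite -map_comp -[RHS](mkseq_nth 0) /mkseq.
by rewrite nth_shape.
Qed.

Lemma filling_tab b t : perm_eq t (boxes b) -> filling b (tab b t).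
Proof.
move=> pt; split; first exact: shape_tab.
have ut : uniq t by rewrite (perm_uniq pt) boxes_uniq.
rewrite flatten_tab -size_boxes -(perm_size pt) -(addn0 1) iotaDl -(map_index_id ut) -map_comp.
by rewrite perm_sym; apply: perm_map.
Qed.

(** Sorting the boxes by their entries gives [t]: the sorted entries are 1, ..., n, so each box
    stands at the position given by its entry. *)
Lemma filling_tab_ex b T : filling b T -> exists2 t, perm_eq t (boxes b) & T = tab b t.
Proof.
move=> [sT pT]; pose t := sort (relpre (entry T) leq) (boxes b).
have pt : perm_eq t (boxes b) by rewrite perm_sort.
have ut : uniq t by rewrite (perm_uniq pt) boxes_uniq.
have et : map (entry T) t = iota 1 (sumn b).
  rewrite /t -sort_map -sT boxes_filling sT -[RHS](@sorted_sort _ leq); last exact: iota_sorted.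
    by apply/perm_sortP => //; [exact: leq_total|exact: leq_trans|exact: anti_leq].
  exact: leq_trans.
exists t => //; apply: eq_from_flatten_shape; last by rewrite shape_tab.
rewrite flatten_tab -boxes_filling sT; apply/eq_in_map => x.
rewrite -(perm_mem pt) => xt.
have it : index x t < size t by rewrite index_mem.
rewrite -{1}(nth_index (0, 0) xt) -(nth_map _ 0) // et nth_iota ?add1n //.
by rewrite -size_boxes -(perm_size pt).
Qed.

Lemma tab_inj b : {in [pred t | perm_eq t (boxes b)] &, injective (tab b)}.
Proof.
move=> t1 t2; rewrite !inE => p1 p2 e.
apply: eq_from_index; first by rewrite (perm_uniq p1) boxes_uniq.
  by rewrite (permPl p1) perm_sym.
move=> x; rewrite (perm_mem p1) mem_boxes => xb; apply: succn_inj.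
by rewrite -(entry_tab t1 xb) -(entry_tab t2 xb) e.
Qed.

Lemma is_peak_compP b : reflect
  ((forall r, r < size b -> 0 < nth 0 b r) /\ (forall r, r.+1 < size b -> 1 < nth 0 b r))
  (is_peak_comp b).
Proof.
apply: (iffP andP) => -[h1 h2]; split.
- by move=> r rb; apply: (all_nthP 0 h1).
- move=> r rb; have := all_nthP 0 h2 r; rewrite size_take nth_take; last by lia.
  by apply; case: ifP; lia.
- by apply/(all_nthP 0) => r; apply: h1.
- apply/(all_nthP 0) => r; rewrite size_take => rb; rewrite nth_take; last by case: ifP rb; lia.
  by apply: h2; case: ifP rb; lia.
Qed.

Lemma count_leq_sorted k s c : sorted ltn s ->
  (c < count (fun v => v <= k) s) = (c < size s) && (nth 0 s c <= k).
Proof.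
elim: s c => //= v s IH c; rewrite path_sortedE; last exact: ltn_trans.
case/andP=> /allP vs ss; case: (leqP v k) => vk /=.
  by case: c => [|c] /=; rewrite ?vk // add1n !ltnS IH.
rewrite add0n (eq_in_count (a2 := pred0)); last first.
  by move=> w /vs /= vw; apply/negbTE; lia.
rewrite count_pred0; case: c => [|c] //=; first by rewrite [v <= k]leqNgt vk.
rewrite ltnS; apply/esym/negbTE; case: (ltnP c (size s)) => //= cs; rewrite -ltnNge.
by have /= := vs _ (mem_nth 0 cs); exact: ltn_trans vk.
Qed.

Lemma peak_relP b t : respects box_rel t -> perm_eq t (boxes b) -> is_peak_comp b ->
  [/\ forall c c' r, c < c' -> c' < nth 0 b r -> index (c, r) t < index (c', r) t &
      forall r r', r < r' -> r' < size b -> index (1, r) t < index (0, r') t].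
Proof.
move=> /respectsP rt pt /is_peak_compP[b1 b2].
have row c r : c.+1 < nth 0 b r -> index (c, r) t < index (c.+1, r) t.
  move=> cr; apply: rt; rewrite ?(perm_mem pt) ?mem_boxes ?/box_rel /= ?eqxx //.
  exact: ltnW.
have pk r : r.+1 < size b -> index (1, r) t < index (0, r.+1) t.
  by move=> rb; apply: rt; rewrite ?(perm_mem pt) ?mem_boxes ?/box_rel /= ?eqxx ?orbT ?b1 ?b2.
split=> [c c' r|r r'].
  elim: c' => // c' IH; rewrite ltnS leq_eqVlt => /predU1P[->|cc'] h; first exact: row.
  by apply: ltn_trans (row _ _ h); apply: IH => //; exact: ltnW.
elim: r' => // r' IH; rewrite ltnS leq_eqVlt => /predU1P[->|rr'] h; first exact: pk.
apply: ltn_trans (pk _ h); apply: ltn_trans (IH rr' (ltnW h)) _.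
by apply: row; apply: b2.
Qed.

(** When a_(r+1) enters, row r stops being the last row and must already have two boxes, whence b_r
    < a_(r+1). Conversely, under these inequalities the entries at most k occupy an initial block of
    rows, and all of these rows but the top one already contain their second box. *)
Lemma SPIT_tab b t : is_peak_comp b -> perm_eq t (boxes b) ->
  SPIT b (tab b t) <-> respects box_rel t.
Proof.
move=> pb pt; have ut : uniq t by rewrite (perm_uniq pt) boxes_uniq.
have [b1 b2] := is_peak_compP _ pb; split=> [[_ [rows _] pk]|rt].
  apply/respectsP => -[c r] [c' r']; rewrite !(perm_mem pt) !mem_boxes /= => h h'.
  case/orP => [/eqP[? ?]|/andP[/eqP/= ? /eqP[? ?]]]; subst c' r'.
    have /(all_nthP [::])/(_ r) := rows; rewrite size_map size_iota => /(_ (nth_pos_lt h)).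
    move=> /(sorted_ltn_nth ltn_trans 0)/(_ c c.+1); rewrite nth_tab ?(nth_pos_lt h) // !inE.
    rewrite size_map size_iota => /(_ h h' (ltnSn _)).
    by rewrite !(nth_map 0) ?size_iota // !nth_iota.
  subst c; have eh' := @entry_tab b t (0, r.+1) h'.
  have rb := nth_pos_lt h'.
  (* The peak condition is used with k equal to the first entry of row r+1. *)
  have [|b' pb' eb] := pk (entry (tab b t) (0, r.+1)).
    rewrite eh' /= -size_boxes -(perm_size pt) index_mem (perm_mem pt) mem_boxes //.
  have h1 : diagram b' (0, r.+1) by rewrite -eb.
  have [_ b2'] := is_peak_compP _ pb'.
  have : diagram b' (1, r) by apply: b2'; apply: nth_pos_lt h1.
  rewrite -eb => -[_]; rewrite eh' entry_tab // ltnS leq_eqVlt => /predU1P[e|//].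
  have x1 : (1, r) \in t by rewrite (perm_mem pt) mem_boxes.
  have x2 : (0, r.+1) \in t by rewrite (perm_mem pt) mem_boxes.
  by have := nth_index (0,0) x1; rewrite e nth_index.
have [rowlt col] := peak_relP rt pt pb.
have srow r : r < size b -> sorted ltn (nth [::] (tab b t) r).
  move=> rb; rewrite nth_tab // sorted_pairwise; last exact: ltn_trans.
  rewrite pairwise_map; apply/(pairwiseP 0) => i j; rewrite !inE size_iota => ir jr ij /=.
  by rewrite !nth_iota // !add0n ltnS; apply: rowlt.
split; first exact: filling_tab.
  split.
    by apply/(all_nthP [::]) => r; rewrite size_map size_iota; apply: srow.
  rewrite sorted_pairwise; last exact: ltn_trans.
  rewrite pairwise_map; apply: pairwise_filter; rewrite pairwise_map.
  apply/(pairwiseP 0) => i j; rewrite !inE !size_iota => ib jb ij /=; rewrite !nth_iota // !add0n.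
  rewrite !(nth_map 0) ?size_iota ?b1 // !nth_iota ?b1 //= ltnS.
  by apply: ltn_trans (col _ _ ij jb); apply: rowlt => //; apply: b2; apply: leq_ltn_trans jb.
(* [m] is the first row whose first entry exceeds [k], or [size b] if there is none; the rows below
   [m] are those that meet the entries at most [k]. *)
move=> k kb; pose m := find (fun row => k < nth 0 row 0) (tab b t).
have mb : m <= size b by rewrite (leq_trans (find_size _ _)) // size_map size_iota.
pose b' := [seq count (fun v => v <= k) row | row <- take m (tab b t)].
have sb' : size b' = m by rewrite size_map size_takel // size_map size_iota.
have b'E r : r < m -> nth 0 b' r = count (fun v => v <= k) (nth [::] (tab b t) r).
  by move=> rm; rewrite (nth_map [::]) ?nth_take // size_takel // size_map size_iota.
have head r : r < size b -> nth 0 (nth [::] (tab b t) r) 0 = (index (0, r) t).+1.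
  by move=> rb; rewrite nth_tab // (nth_map 0) ?size_iota ?b1 // nth_iota // b1.
have b'P c r : r < m -> (c < nth 0 b' r) = (c < nth 0 b r) && ((index (c, r) t).+1 <= k).
  move=> rm; have rb := leq_trans rm mb; rewrite b'E // count_leq_sorted; last exact: srow.
  rewrite nth_tab // size_map size_iota.
  by case cb: (c < _) => //; rewrite (nth_map 0) ?size_iota // nth_iota.
have ltm r : r < m -> (index (0, r) t).+1 <= k.
  move=> rm; have := before_find [::] rm; rewrite head; last exact: leq_trans mb.
  by move/negbT; rewrite -leqNgt.
exists b'.
  apply/is_peak_compP; rewrite sb'; split=> r rm; rewrite b'P //.
  - by rewrite b1 ?ltm // (leq_trans rm).
  - rewrite b2 /=; last by apply: leq_trans rm mb.
    by apply: ltn_trans (ltm _ rm); apply: col => //; apply: leq_trans rm mb.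
  - exact: ltnW.
apply/predeqP => -[c r]; rewrite /diagram /=; case: (ltnP r m) => rm.
  rewrite b'P //; split=> [[h]|/andP[h]]; first by rewrite entry_tab // h => ->.
  by rewrite entry_tab.
rewrite [nth 0 b' r]nth_default ?sb' //; split=> // -[h]; rewrite entry_tab //= => ek.
have rb := nth_pos_lt h.
have mT : m < size b by apply: leq_ltn_trans rb.
have : k < nth 0 (nth [::] (tab b t) m) 0.
  have := nth_find [::] (a := fun row => k < nth 0 row 0) (s := tab b t).
  by rewrite has_find -/m size_map size_iota => /(_ mT).
(* A box with entry at most [k] in row [m] or above would force the first entry of row [m] to be at
   most [k]. *)
rewrite head // => km; suff : (index (0, m) t).+1 <= k by rewrite leqNgt km.
have le1 : index (0, r) t <= index (c, r) t.
  by case: c h {ek} => // c h; apply: ltnW; apply: rowlt.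
have le2 : index (0, m) t <= index (0, r) t.
  move: rm; rewrite leq_eqVlt => /predU1P[->//|rm]; apply: ltnW.
  by apply: ltn_trans (col _ _ rm rb); apply: rowlt => //; apply: b2; apply: leq_ltn_trans rb.
by apply: leq_trans ek; rewrite ltnS (leq_trans le2).
Qed.

(** The extra condition [C] serves both families: it is trivial for [Qtilde] and becomes
    [young_triple] for [Stilde]. *)
Lemma sum_SPIT (V : zmodType) b (C : set (seq (seq nat))) (F : seq (seq nat) -> V) :
    is_peak_comp b ->
  (\sum_(T \in SPIT b `&` C) F T =
   \sum_(t <- [seq t <- linexts box_rel (boxes b) | `[<C (tab b t)>]]) F (tab b t))%R.
Proof.
move=> pb; pose lT := [seq t <- linexts box_rel (boxes b) | `[<C (tab b t)>]].
suff bij : set_bij [set` lT] (SPIT b `&` C) (tab b).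
  by rewrite (@reindex_fsbig _ _ _ _ _ _ _ _ F bij) -fsbig_seq // filter_uniq ?linexts_uniq.
split.
- move=> t /=; rewrite mem_filter linextsP => /andP[/asboolP Ct /andP[pt rt]].
  by split=> //; apply/SPIT_tab.
- have lTP t : t \in [set` lT] -> perm_eq t (boxes b).
    by move=> /set_mem /=; rewrite mem_filter linextsP => /and3P[].
  by move=> t1 t2 /lTP p1 /lTP p2; apply: (@tab_inj b).
- move=> T [ST CT]; have [fT _ _] := ST; have [t pt eT] := filling_tab_ex fT.
  exists t => //=; rewrite mem_filter linextsP pt /= -eT asboolT //=.
  by apply/(SPIT_tab pb pt); rewrite -eT.
Qed.

(** * Reading words, and both functions as sums over linear extensions *)

Lemma column_tab b t c : column (tab b t) c = [seq (index x t).+1 | x <- colbox b c].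
Proof.
rewrite /column /tab filter_map /colbox -!map_comp.
rewrite (eq_filter (a2 := fun r => c < nth 0 b r)); last first.
  by move=> r; rewrite /= size_map size_iota.
apply/eq_in_map => r; rewrite mem_filter mem_iota /= => /andP[cr _].
by rewrite (nth_map 0) ?size_iota // nth_iota.
Qed.

Lemma ltn_ncols_tab b t x : x.1 < nth 0 b x.2 -> x.1 < ncols (tab b t).
Proof.
move=> h; rewrite /ncols -(big_map size xpredT id) -/(shape _) shape_tab.
have bx := mem_nth 0 (nth_pos_lt h).
exact: leq_trans h (@leq_bigmax_seq _ _ xpredT id _ bx isT).
Qed.

Lemma wc_tab b t :
  wc (tab b t) = [seq (index x t).+1 | x <- read_boxes pred0 b (iota 0 (ncols (tab b t)))].
Proof.
rewrite /wc /read_boxes map_flatten -map_comp; congr flatten.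
by apply: eq_map => c; rewrite column_tab.
Qed.

Lemma wY_tab b t :
  wY (tab b t) =
  [seq (index x t).+1 | x <- read_boxes (pred1 0) b (0 :: iota 1 (ncols (tab b t)).-1)].
Proof.
rewrite /wY /read_boxes /= map_cat map_rev column_tab map_flatten -map_comp; congr (_ ++ flatten _).
by apply/eq_in_map => c; rewrite mem_iota /= column_tab; case: c.
Qed.

Definition Kdes n (D : seq nat) : series := Kfun (comp_of_set n (Peak D)).

Lemma Des_wc_tab b t : perm_eq t (boxes b) ->
  Des (wc (tab b t)) = des box0 (read_key pred0 (size b)) t.
Proof.
move=> pt; rewrite wc_tab; have scs := iota_ltn_sorted 0 (ncols (tab b t)).
apply: Des_index (read_boxes_pairwise _ _ scs); first by rewrite (perm_uniq pt) boxes_uniq.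
rewrite (permPr pt); apply: perm_read_boxes => // x /ltn_ncols_tab h.
by rewrite mem_iota h.
Qed.

Lemma Des_wY_tab b t : perm_eq t (boxes b) ->
  Des (wY (tab b t)) = des box0 (read_key (pred1 0) (size b)) t.
Proof.
move=> pt; rewrite wY_tab.
have scs : sorted ltn (0 :: iota 1 (ncols (tab b t)).-1).
  exact: (iota_ltn_sorted 0 (ncols (tab b t)).-1.+1).
apply: Des_index (read_boxes_pairwise _ _ scs); first by rewrite (perm_uniq pt) boxes_uniq.
rewrite (permPr pt); apply: perm_read_boxes => // x /ltn_ncols_tab-/(_ t) h.
by rewrite inE mem_iota; lia.
Qed.

Lemma Qtilde_linexts b : is_peak_comp b ->
  Qtilde b = (\sum_(t <- linexts box_rel (boxes b))
                Kdes (sumn b) (des box0 (read_key pred0 (size b)) t))%R.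
Proof.
move=> pb; rewrite /Qtilde -[SPIT b]setIT sum_SPIT // (eq_filter (a2 := xpredT)); last first.
  by move=> t; apply/asboolP.
rewrite filter_predT; apply: eq_big_seq => t.
by rewrite linextsP => /andP[pt _]; rewrite Des_wc_tab.
Qed.

Lemma Stilde_linexts b : is_peak_comp b ->
  Stilde b = (\sum_(t <- [seq t <- linexts box_rel (boxes b) | `[<young_triple b (tab b t)>]])
                Kdes (sumn b) (des box0 (read_key (pred1 0) (size b)) t))%R.
Proof.
move=> pb; rewrite /Stilde.
have -> : SPYCT b = SPIT b `&` young_triple b.
  apply/seteqP; split=> T; first by move=> [[fT rT yT] pT]; split.
  by move=> [[fT rT pT] yT]; split.
rewrite sum_SPIT //; apply: eq_big_seq => t.
by rewrite mem_filter linextsP => /and3P[_ pt _]; rewrite Des_wY_tab.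
Qed.

End Tableaux.

(** * The composition Delta_S *)

(** Length of the run of [P] that ends at [k.-1]; for [k] outside S this is the number of boxes that
    Delta_S adds to row [k]. *)
Fixpoint run_below (P : pred nat) (k : nat) : nat :=
  if k is k'.+1 then if P k' then (run_below P k').+1 else 0 else 0.

Lemma run_below_le P k : run_below P k <= k.
Proof. by elim: k => //= k IH; case: (P k). Qed.

Lemma run_belowS (P : pred nat) k : P k -> run_below P k.+1 = (run_below P k).+1.
Proof. by move=> /= ->. Qed.

Lemma run_belowP P k m : k - run_below P k <= m < k -> P m.
Proof.
elim: k => [|k IH] /=; first by lia.
case Pk: (P k); last by lia.
rewrite subSS ltnS => /andP[h1 h2]; move: h2; rewrite leq_eqVlt => /predU1P[->//|h2].
by apply: IH; rewrite h1.
Qed.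

Lemma run_below_stop P k : run_below P k < k -> ~~ P (k - run_below P k).-1.
Proof.
elim: k => //= k IH; case Pk: (P k); last by rewrite subn0 /= Pk.
by rewrite subSS ltnS; apply: IH.
Qed.

Lemma run_below_ge (P : pred nat) k r : (forall m, k <= m < r -> P m) -> r - k <= run_below P r.
Proof.
move=> h; rewrite leqNgt; apply/negP => lt.
have := run_below_stop (P := P) (k := r) (leq_trans lt (leq_subr _ _)).
by apply/negP; rewrite negbK; apply: h; lia.
Qed.

Definition ord_pred_nat l (S : {set 'I_l}) : pred nat :=
  fun k => if insub k is Some i then i \in S else false.

Lemma ord_pred_natE l (S : {set 'I_l}) (i : 'I_l) : ord_pred_nat S i = (i \in S).
Proof. by rewrite /ord_pred_nat valK. Qed.

Lemma ord_pred_nat_ex l (S : {set 'I_l}) k :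
  ord_pred_nat S k -> exists2 i : 'I_l, k = i & i \in S.
Proof. by rewrite /ord_pred_nat; case: insubP => // i _ <- iS; exists i. Qed.

Definition max_run (P : pred nat) (i j : nat) : Prop :=
  [/\ i <= j, forall m, i <= m <= j -> P m, ~~ P j.+1 & 0 < i -> ~~ P i.-1].

(** An interval contained in a strictly larger one inside S can be enlarged by one of its two
    neighbours, so maximality need only be tested there. *)
Lemma max_itvP l (S : {set 'I_l}) (i j : 'I_l) :
  reflect (max_run (ord_pred_nat S) i j) (max_itv S i j).
Proof.
have sub (i' j' : 'I_l) : reflect (forall m, i' <= m <= j' -> ord_pred_nat S m) (itv i' j' \subset S).
  apply: (iffP fintype.subsetP) => [h m mij|h m]; last by rewrite inE -ord_pred_natE; apply: h.
  have ml : m < l by apply: leq_ltn_trans (ltn_ord j'); case/andP: mij.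
  by rewrite -[m]/(val (Ordinal ml)) ord_pred_natE; apply: h; rewrite inE.
apply: (iffP and3P) => [[ij /sub ijS /forallP mx]|[ij ijS nj ni]].
  split=> //.
    apply/negP => Pj; have [j' ej' _] := ord_pred_nat_ex Pj.
    move/forallP: (mx i) => /(_ j'); rewrite leqnn -ej' leqnSn /=.
    have -> : itv i j' \subset S.
      apply/sub => m; rewrite -ej' => /andP[im]; rewrite leq_eqVlt => /predU1P[->//|mj].
      by apply: ijS; rewrite im.
    by rewrite -!val_eqE /= -ej'; lia.
  move=> i0; apply/negP => Pi; have [i' ei' _] := ord_pred_nat_ex Pi.
  move/forallP: (mx i') => /(_ j); rewrite leqnn -ei' leq_pred /=.
  have -> : itv i' j \subset S.
    apply/sub => m; rewrite -ei' => /andP[im mj].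
    have [im'|im'] := leqP i m; first by apply: ijS; rewrite im'.
    by have -> : m = i.-1 by lia.
  by rewrite -!val_eqE /= -ei'; lia.
split; [by []|exact/sub|].
apply/forallP => i'; apply/forallP => j'; apply/implyP => /and3P[ii' jj' /sub h].
rewrite -!val_eqE /=; apply/andP; split.
  rewrite eqn_leq ii' leqNgt; apply/negP => lt.
  by move/negP: (ni (leq_ltn_trans (leq0n _) lt)); apply; apply: h; lia.
rewrite eqn_leq jj' andbT leqNgt; apply/negP => lt.
by move/negP: nj; apply; apply: h; lia.
Qed.

(** [Delta_itv] changes each part independently of the values of the others, so the iterated
    operation can be followed on the single part [k]. *)
Definition itv_effect (k : nat) (v : nat) (p : nat * nat) : nat :=
  if p.1 <= k <= p.2 then v.-1 else if k == p.2.+1 then v + (p.2 - p.1).+1 else v.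

Lemma nth_foldl_Delta_itv (T : Type) (f : T -> nat * nat) (L : seq T) g k : k < size g ->
  nth 0 (foldl (fun g p => Delta_itv (f p).1 (f p).2 g) g L) k =
  foldl (fun v p => itv_effect k v (f p)) (nth 0 g k) L.
Proof.
elim: L g => //= p L IH g kg; rewrite IH ?size_mkseq //.
by rewrite nth_mkseq.
Qed.

Lemma size_foldl_Delta_itv (T : Type) (f : T -> nat * nat) (L : seq T) g :
  size (foldl (fun g p => Delta_itv (f p).1 (f p).2 g) g L) = size g.
Proof. by elim: L g => //= p L IH g; rewrite IH size_mkseq. Qed.

Definition itv_affects k (p : nat * nat) := p.1 <= k <= p.2.+1.

Lemma itv_effect_id k v p : p.1 <= p.2 -> ~~ itv_affects k p -> itv_effect k v p = v.
Proof.
rewrite /itv_affects /itv_effect => h1 h2.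
by rewrite ifF; [rewrite ifF //|]; apply: contraNF h2; lia.
Qed.

Lemma foldl_itv_effect_id (T : Type) (f : T -> nat * nat) (L : seq T) k v :
  all (fun p => (f p).1 <= (f p).2) L -> ~~ has (fun p => itv_affects k (f p)) L ->
  foldl (fun v p => itv_effect k v (f p)) v L = v.
Proof.
elim: L v => //= p L IH v /andP[p12 aL]; rewrite negb_or => /andP[np nL].
by rewrite itv_effect_id // IH.
Qed.

(** If a single interval of the list reaches part [k], the order of the list has no influence on
    that part. *)
Lemma foldl_itv_effect1 (T : eqType) (f : T -> nat * nat) (L : seq T) k v p0 :
    uniq L -> all (fun p => (f p).1 <= (f p).2) L -> p0 \in L ->
    {in L, forall p, itv_affects k (f p) -> p = p0} ->
  foldl (fun v p => itv_effect k v (f p)) v L = itv_effect k v (f p0).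
Proof.
elim: L v => //= p L IH v /andP[pL uL] /andP[p12 aL]; rewrite inE => p0L h.
have hL q : q \in L -> itv_affects k (f q) -> q = p0 by move=> qL; apply: h; rewrite inE qL orbT.
case/predU1P: p0L => [e|p0L]; last first.
  rewrite itv_effect_id ?IH //; apply/negP => /h; rewrite mem_head => /(_ isT) e.
  by rewrite e p0L in pL.
rewrite foldl_itv_effect_id -?e //; apply/hasPn => q qL; apply/negP => /(hL _ qL) eq.
by move: qL; rewrite eq e (negPf pL).
Qed.

Lemma size_Delta a (S : {set 'I_(size a)}) : size (Delta S) = size a.
Proof. exact: (size_foldl_Delta_itv (fun p : 'I__ * 'I__ => (val p.1, val p.2))). Qed.

Lemma max_run_uniq P k i j i' j' : max_run P i j -> max_run P i' j' ->
  i <= k <= j -> i' <= k <= j' -> (i = i') /\ (j = j').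
Proof.
move=> [ij Pij nj ni] [ij' Pij' nj' ni'] k1 k2; split.
  have [lt|lt|//] := ltngtP i i'.
    by have /negP := ni' (leq_ltn_trans (leq0n _) lt); case; apply: Pij; lia.
  by have /negP := ni (leq_ltn_trans (leq0n _) lt); case; apply: Pij'; lia.
have [lt|lt|//] := ltngtP j j'.
  by move/negP: nj; case; apply: Pij'; lia.
by move/negP: nj'; case; apply: Pij; lia.
Qed.

(** Distinct maximal intervals are separated by an element outside S, so a part is changed by at
    most one of them: the interval containing it, which turns 3 into 2, or the one ending just below
    it, which adds its length. *)
Lemma nth_Delta a (S : {set 'I_(size a)}) k : S \subset Iset a -> k < size a ->
  nth 0 (Delta S) k =
  if ord_pred_nat S k then 2 else nth 0 a k + run_below (ord_pred_nat S) k.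
Proof.
move=> SI ka; set P := ord_pred_nat S.
pose f (p : 'I_(size a) * 'I_(size a)) := (val p.1, val p.2).
rewrite /Delta (@nth_foldl_Delta_itv _ f) //; set L := enum _.
have LP (p : 'I_(size a) * 'I_(size a)) : reflect (max_run P p.1 p.2) (p \in L) by rewrite mem_enum; apply: max_itvP.
have uL : uniq L by apply: enum_uniq.
have aL : all (fun p => (f p).1 <= (f p).2) L by apply/allP => p /LP[].
have finj p q : (f p).1 = (f q).1 -> (f p).2 = (f q).2 -> p = q.
  by case: p q => [p1 p2] [q1 q2] /= /val_inj -> /val_inj ->.
case: ifP => Pk.
  have [ko eko koS] := ord_pred_nat_ex Pk.
  have a3 : nth 0 a k = 3.
    by move/fintype.subsetP/(_ _ koS): SI; rewrite inE -eko => /and3P[_ /eqP].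
  (* The upper end of the run through [k] is the largest [j] with k, ..., j all in [P]; the lower
     end is given by [run_below]. *)
  pose ex_j := fun j => (k <= j < size a) && all P (iota k (j - k).+1).
  have exj : exists j, ex_j j by exists k; rewrite /ex_j leqnn ka subnn /= Pk.
  have [|j /andP[kj /allP Pj] jmax] := @ex_maxnP ex_j (size a) exj.
    by move=> j /andP[/andP[_ /ltnW]].
  case/andP: kj => kj ja; pose i := k - run_below P k.
  have ik : i <= k by exact: leq_subr.
  have ia : i < size a by apply: leq_ltn_trans ka.
  have mr : max_run P i j.
    split; first exact: leq_trans kj.
    - move=> m /andP[im mj]; have [km|mk] := leqP k m.
        by apply: Pj; rewrite mem_iota; lia.
      by apply: (@run_belowP _ k); rewrite im.
    - apply/negP => Pj1; have [jo ejo _] := ord_pred_nat_ex Pj1.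
      have : j.+1 <= j; last by rewrite ltnn.
      apply: jmax; apply/andP; split; first by rewrite {2}ejo ltn_ord (leq_trans kj).
      apply/allP => m; rewrite mem_iota => mkj; have [->//|ne] := eqVneq m j.+1.
      by apply: Pj; rewrite mem_iota; lia.
    - by rewrite /i => i0; apply: run_below_stop; lia.
  rewrite (@foldl_itv_effect1 _ f L k _ (Ordinal ia, Ordinal ja)) //.
  - by rewrite /itv_effect /= ik kj a3.
  - by apply/LP.
  - move=> p /LP mp; rewrite /itv_affects => hp.
    have [||e1 e2] := @max_run_uniq P k _ _ _ _ mp mr _ _; [|by rewrite ik|exact: finj].
    case: mp => _ _ nj _; case/andP: hp => /= -> /=.
    by rewrite leq_eqVlt => /predU1P[e|//]; rewrite -e Pk in nj.
have noin (p : 'I_(size a) * 'I_(size a)) : p \in L -> p.1 <= k <= p.2 -> False by move=> /LP[_ h _ _] /h; rewrite Pk.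
have affP p : p \in L -> itv_affects k (f p) -> k = p.2.+1.
  move=> pL; rewrite /itv_affects /= => /andP[pk]; rewrite leq_eqVlt => /predU1P[//|kp].
  by case: (noin p pL); rewrite pk.
(* A part outside S grows exactly when a run ends at [k.-1]. *)
have [r0|r0] := posnP (run_below P k).
  rewrite foldl_itv_effect_id ?r0 ?addn0 //; apply/hasPn => p pL; apply/negP => /(affP _ pL) e.
  have /LP[_ h _ _] := pL; have : P p.2 by apply: h; rewrite leqnn andbT; have /LP[] := pL.
  by move/(@run_belowS P); rewrite -e r0.
have kr := run_below_le P k.
have ia : k - run_below P k < size a by apply: leq_ltn_trans ka; apply: leq_subr.
have ja : k.-1 < size a by apply: leq_ltn_trans ka; apply: leq_pred.
have mr : max_run P (k - run_below P k) k.-1.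
  split; first by lia.
  - by move=> m hm; apply: (@run_belowP _ k); lia.
  - by rewrite prednK ?Pk //; lia.
  - by move=> h; apply: run_below_stop; lia.
rewrite (@foldl_itv_effect1 _ f L k _ (Ordinal ia, Ordinal ja)) //.
- rewrite /itv_effect /= prednK; last by lia.
  by rewrite eqxx ifF; lia.
- by apply/LP.
- move=> p pL /(affP _ pL) e; have /LP mp := pL.
  have [||e1 e2] := @max_run_uniq P k.-1 _ _ _ _ mp mr _ _; last exact: finj.
  + by case: mp => h _ _ _; rewrite e /= h leqnn.
  + by rewrite leqnn andbT; lia.
Qed.

(** * From the boxes of Delta_S to those of alpha *)

Definition last_box (a : seq nat) (r : nat) : box := ((nth 0 a r).-1, r).

Definition last_box_lt (a : seq nat) (t : seq box) (i : nat) : bool :=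
  index (last_box a i.+1) t < index (last_box a i) t.

Section Shift.
(** In the application [P] is the set S and [b] is Delta_S of [a]. *)
Variables (a b : seq nat) (P : pred nat).
Hypothesis peak_a : is_peak_comp a.
Hypothesis a_le3 : forall r, nth 0 a r <= 3.
Hypothesis P_spec : forall k, P k -> [/\ k.+1 < size a, nth 0 a k = 3 & nth 0 a k.+1 != 1].
Hypothesis size_b : size b = size a.
Hypothesis nth_b : forall k, k < size a ->
  nth 0 b k = if P k then 2 else nth 0 a k + run_below P k.

Let a1 : forall r, r < size a -> 0 < nth 0 a r.
Proof. by case/is_peak_compP: peak_a. Qed.

Let a2 : forall r, r.+1 < size a -> 1 < nth 0 a r.
Proof. by case/is_peak_compP: peak_a. Qed.

Lemma shift_peak_comp : is_peak_comp b.
Proof.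
apply/is_peak_compP; rewrite size_b; split=> r ra; rewrite nth_b ?(ltnW ra) //; case: ifP => // _.
  by rewrite addn_gt0 a1.
by apply: leq_trans (a2 ra) (leq_addr _ _).
Qed.

(* The last boxes of the rows in a run of [P] are those moved to the row just above the run. *)
Definition shift_box (x : box) : box :=
  if x.1 < nth 0 a x.2 then x else (2, x.2.-1 - (x.1 - nth 0 a x.2)).

Lemma shift_boxP c r : (c, r) \in boxes b ->
  (c < nth 0 a r /\ shift_box (c, r) = (c, r)) \/
  [/\ nth 0 a r <= c, ~~ P r, c - nth 0 a r < run_below P r,
      P (r.-1 - (c - nth 0 a r)) & shift_box (c, r) = (2, r.-1 - (c - nth 0 a r))].
Proof.
rewrite mem_boxes /= => cb; have ra : r < size a by rewrite -size_b; apply: nth_pos_lt cb.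
rewrite /shift_box /=; case: ifP => ca; [by left|right].
move: cb; rewrite nth_b //; case: ifP => Pr.
  by have [_ a3 _] := P_spec Pr; move: ca; rewrite a3; lia.
have rr := run_below_le P r; move=> cb; split=> //; [lia|lia|].
by apply: (@run_belowP _ r); lia.
Qed.

Lemma shift_box_in x : x \in boxes b -> shift_box x \in boxes a.
Proof.
case: x => c r /shift_boxP[[h ->]|[_ _ _ Pk ->]]; rewrite mem_boxes //=.
by have [_ -> _] := P_spec Pk.
Qed.

(** An unmoved box is never the third box of a row in [P], since such rows have length 2 in [b]. Two
    moved boxes with one image lie in one row: otherwise the lower of their rows would belong to the
    run below the higher one, although it is outside [P]. *)
Lemma shift_box_inj : {in boxes b &, injective shift_box}.
Proof.
have aux c r k : (c, r) \in boxes b -> c < nth 0 a r -> P k -> (c, r) <> (2, k).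
  rewrite mem_boxes /= => cb ca Pk [ec er]; move: cb.
  by rewrite ec er nth_b ?Pk //; have [/ltnW] := P_spec Pk.
have aux2 r r' k : k < r -> r < r' -> r' - run_below P r' <= k -> P r.
  by move=> kr rr' h; apply: (@run_belowP _ r'); lia.
move=> [c r] [c' r'] xb yb.
case: (shift_boxP xb) => [[h ->]|[h1 h2 h3 h4 ->]];
  case: (shift_boxP yb) => [[h' ->]|[h1' h2' h3' h4' ->]] //.
- by move=> e; case: (aux _ _ _ xb h h4').
- by move=> /esym e; case: (aux _ _ _ yb h' h4).
have rr := run_below_le P r; have rr' := run_below_le P r'.
case=> e; have [lt|lt|err] := ltngtP r r'.
- by move/negP: h2; case; apply: (aux2 r r' r.-1); lia.
- by move/negP: h2'; case; apply: (aux2 r' r r'.-1); lia.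
by subst r'; congr pair; lia.
Qed.

Lemma run_top k : P k ->
  exists r, [/\ k < r, r < size a, ~~ P r & forall m, k <= m < r -> P m].
Proof.
move=> Pk; have ex : exists r, (k < r) && ~~ P r.
  (* A row above [k] and beyond the size of [a] is certainly outside [P]. *)
  exists (size a + k.+1); rewrite ltn_addl //=; apply/negP => /P_spec[h _ _].
  by move: h; lia.
have [r /andP[kr nPr] rmin] := ex_minnP ex.
have Pm m : k <= m < r -> P m.
  move=> /andP[km mr]; move: km; rewrite leq_eqVlt => /predU1P[<-//|km].
  apply/negPn/negP => nPm; have := rmin m; rewrite km nPm => /(_ isT).
  by rewrite leqNgt mr.
exists r; split=> //; have /P_spec[h _ _] : P r.-1 by apply: Pm; lia.
by move: h; rewrite prednK //; apply: leq_ltn_trans kr.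
Qed.

Lemma shift_box_top k r m : k < r -> r < size a -> ~~ P r -> (forall m, k <= m < r -> P m) ->
  k <= m < r ->
  (nth 0 a r + (r.-1 - m), r) \in boxes b /\ shift_box (nth 0 a r + (r.-1 - m), r) = (2, m).
Proof.
move=> kr ra nPr Pm kmr; have rk := run_below_ge Pm.
rewrite mem_boxes /= nth_b // (negPf nPr) ltn_add2l; split; first by lia.
by rewrite /shift_box /= ltnNge leq_addr /=; congr pair; lia.
Qed.

Lemma perm_shift_boxes : perm_eq (map shift_box (boxes b)) (boxes a).
Proof.
apply: uniq_perm; [|exact: boxes_uniq|].
  by rewrite map_inj_in_uniq ?boxes_uniq //; apply: shift_box_inj.
move=> x; apply/mapP/idP => [[y yb ->]|]; first exact: shift_box_in.
case: x => c k; rewrite mem_boxes /= => ca; have ka := nth_pos_lt ca.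
case Pk: (P k); last first.
  exists (c, k); last by rewrite /shift_box /= ca.
  by rewrite mem_boxes /= nth_b // Pk (leq_trans ca) ?leq_addr.
have [_ a3 _] := P_spec Pk; have [c2|c2] := ltnP c 2.
  exists (c, k); last by rewrite /shift_box /= ca.
  by rewrite mem_boxes /= nth_b // Pk.
have -> : c = 2 by move: ca; rewrite a3; lia.
have [r [kr ra nPr Pm]] := run_top Pk.
have [h1 h2] := shift_box_top kr ra nPr Pm (m := k) ltac:(by rewrite leqnn).
by exists (nth 0 a r + (r.-1 - k), r).
Qed.

Lemma shift_sumn : sumn b = sumn a.
Proof. by rewrite -!size_boxes -(perm_size perm_shift_boxes) size_map. Qed.

(** Above a run i, ..., j the long row of [b] continues its old boxes with c_j, ..., c_i, so its
    increase says exactly that each of these exceeds the last entry of the next row of [a]. The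
    inequality b_k < c_k for k in [P], no longer inside a row of [b], is recovered through the first
    box of the long row. *)
Lemma respects_shift t : perm_eq t (boxes b) ->
  respects box_rel t <->
  respects box_rel (map shift_box t) /\ forall i, P i -> last_box_lt a (map shift_box t) i.
Proof.
move=> pt; set T := map _ t.
have pT : perm_eq T (boxes a) by rewrite -(permPr perm_shift_boxes) perm_map.
have inj : {in t &, injective shift_box}.
  by move=> x y; rewrite !(perm_mem pt); apply: shift_box_inj.
have idx x : x \in boxes b -> index (shift_box x) T = index x t.
  by rewrite -(perm_mem pt); apply: index_map_in.
have fixb x : x.1 < nth 0 a x.2 -> shift_box x = x by rewrite /shift_box => ->.
have memb c r : c < nth 0 a r -> c < 2 \/ ~~ P r -> (c, r) \in boxes b.
  move=> ca h; rewrite mem_boxes /= nth_b ?(nth_pos_lt ca) //.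
  by case: ifP h => Pr [] // _; rewrite (leq_trans ca) ?leq_addr.
have idx1 c r : c < nth 0 a r -> c < 2 \/ ~~ P r -> index (c, r) T = index (c, r) t.
  by move=> ca h; rewrite -idx ?fixb //; apply: memb.
split=> [rt|[/respectsP rT AT]].
  have [row col] := peak_relP rt pt shift_peak_comp.
  split.
    apply/respectsP => -[c r] [c' r']; rewrite !(perm_mem pT) !mem_boxes /= => h h'.
    case/orP => [/eqP[? ?]|/andP[/eqP/= ? /eqP[? ?]]]; subst c' r'.
      (* The case b_r < c_r with c_r moved to row r': here b_r < a_r' < c_r. *)
      have [c1|c1] := boolP ((c == 1) && P r).
        case/andP: c1 => /eqP ? Pr; subst c.
        have [r' [rr' ra nPr Pm]] := run_top Pr.
        have [m1 m2] := shift_box_top rr' ra nPr Pm (m := r) ltac:(by rewrite leqnn).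
        rewrite -m2 idx // idx1 //; last by left.
        have a'1 : 0 < nth 0 a r' by apply: a1.
        apply: ltn_trans (col _ _ rr' _) _; first by rewrite size_b.
        apply: row; first by rewrite addn_gt0 a'1.
        by move: m1; rewrite mem_boxes.
      have h2 : c.+1 < 2 \/ ~~ P r.
        case Pr: (P r) c1; [|by right]; rewrite andbT => c1; left.
        by have [_ a3 _] := P_spec Pr; move: h'; rewrite a3; move/eqP: c1; lia.
      rewrite !idx1 //; last by case: h2 => [/ltnW|]; [left|right].
      by apply: row => //; have := memb _ _ h' h2; rewrite mem_boxes.
    subst c; rewrite !idx1 //; try by left.
    by apply: col => //; rewrite size_b (nth_pos_lt h').
  move=> i Pi; have [_ a3 _] := P_spec Pi.
  have [r [ir ra nPr Pm]] := run_top Pi.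
  have [m1 m2] := shift_box_top ir ra nPr Pm (m := i) ltac:(by rewrite leqnn).
  rewrite /last_box_lt /last_box a3 /= -m2 idx //; rewrite mem_boxes /= in m1.
  (* Either row i+1 is the long row, and its last old box precedes c_i there, or i+1 is still in the
     run, and c_(i+1) is the added box just before c_i. *)
  move: (ir); rewrite leq_eqVlt => /predU1P[->|ir'].
    have r1 := a1 ra; rewrite idx1 ?prednK //; last by right.
    by apply: row => //; rewrite prednK // leq_addr.
  have [m3 m4] := shift_box_top ir ra nPr Pm (m := i.+1) ltac:(by rewrite leqnSn ir').
  have [_ a3' _] := P_spec (Pm i.+1 ltac:(by rewrite leqnSn ir')).
  by rewrite a3' /= -m4 idx //; apply: row => //; rewrite ltn_add2l; lia.
apply/respectsP => -[c r] [c' r'] xt yt; rewrite -!idx -?(perm_mem pt) //.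
rewrite !(perm_mem pt) in xt yt.
have xa := shift_box_in xt; have ya := shift_box_in yt.
rewrite -!(perm_mem pT) in xa ya.
case/orP => [/eqP[? ?]|/andP[/eqP/= ? /eqP[? ?]]]; subst c' r'; last first.
  subst c; have r1 : r.+1 < size a by move: yt; rewrite mem_boxes -size_b => /nth_pos_lt.
  by apply: rT => //; rewrite !fixb ?a1 ?a2 // /box_rel /= eqxx.
have rr := run_below_le P r.
case: (shift_boxP xt) => [[h e]|[h1 h2 h3 h4 e]];
  case: (shift_boxP yt) => [[h' e']|[h1' h2' h3' h4' e']].
- by apply: rT => //; rewrite e e' /box_rel eqxx.
(* [(c, r)] is the last old box of its row and [(c.+1, r)] the first added one, which comes from row
   [r.-1]. *)
- have ac : c.+1 = nth 0 a r by lia.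
  move: AT; rewrite /last_box_lt /last_box => /(_ _ h4'); have [_ -> _] := P_spec h4'.
  rewrite e e'; rewrite -ac subnn subn0.
  by rewrite (prednK (n := r)) ?(leq_trans _ rr) ?(leq_ltn_trans _ h3') // -ac.
- by lia.
- move: AT; rewrite /last_box_lt /last_box => /(_ _ h4'); have [_ -> _] := P_spec h4'.
  have -> : (r.-1 - (c.+1 - nth 0 a r)).+1 = r.-1 - (c - nth 0 a r) by lia.
  by have [_ -> _] := P_spec h4; rewrite e e'.
Qed.

(** Along a row of [b] the added boxes come from lower and lower rows of column 3, so reading that
    column downwards keeps the row increasing in the order of keys. The relation b_r < a_(r+1) goes
    against the key order for both labellings. Thus [linexts_invariant] applies. *)
Lemma sum_linexts_shift (V : nmodType) (G : seq nat -> V) :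
  (\sum_(t <- linexts box_rel (boxes b)) G (des box0 (read_key pred0 (size b)) t) =
   \sum_(t <- linexts box_rel (boxes a) | `[<forall i, P i -> last_box_lt a t i>])
     G (des box0 (read_key (pred1 2) (size a)) t))%R.
Proof.
pose key x := read_key (pred1 2) (size a) (shift_box x).
have shift_row x : x \in boxes b -> (shift_box x).2 < size a.
  by move/shift_box_in; rewrite mem_boxes => /nth_pos_lt.
rewrite (@linexts_invariant _ box0 _ G box_rel _ _ key (boxes_uniq b)); last 3 first.
- move=> x y; rewrite !mem_boxes => /nth_pos_lt xb /nth_pos_lt yb.
  by apply: read_key_inj; rewrite inE.
- move=> x y xb yb e; apply: shift_box_inj => //.
  by apply: read_key_inj e; rewrite inE; apply: shift_row.
- move=> [c r] [c' r'] xb yb.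
  have xN : r < size b by move: xb; rewrite mem_boxes => /nth_pos_lt.
  have yN : r' < size b by move: yb; rewrite mem_boxes => /nth_pos_lt.
  rewrite /key !read_keyP ?shift_row //=.
  case/orP => [/eqP[? ?]|/andP[/eqP/= ? /eqP[? ?]]]; subst c' r'; last first.
    subst c; rewrite size_b in yN.
    have fixb x : x.1 < nth 0 a x.2 -> shift_box x = x by rewrite /shift_box => ->.
    by rewrite !fixb ?a1 ?a2.
  rewrite ltnSn /=; apply/esym; have rr := run_below_le P r; have ar := a_le3 r.
  case: (shift_boxP xb) => [[h ->]|[h1 h2 h3 h4 ->]];
    case: (shift_boxP yb) => [[h' ->]|[h1' h2' h3' h4' ->]] //=; try lia.
  (* An old box followed by an added one: the old box may itself lie in column 3, and then the added
     one comes from a strictly lower row. *)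
  have r0 : 0 < r by apply: leq_trans rr; apply: leq_ltn_trans h3'.
  by have := leq_trans h ar; case: c {h h1' h2' h3' h4' xb yb} => [|[|[|c]]] //= _; lia.
rewrite -[RHS]big_filter; set L := [seq t <- _ | _].
have pL : perm_eq L (map (map shift_box) (linexts box_rel (boxes b))).
  apply: uniq_perm; first by rewrite filter_uniq ?linexts_uniq.
    rewrite map_inj_in_uniq ?linexts_uniq // => t1 t2.
    rewrite !linextsP => /andP[p1 _] /andP[p2 _].
    apply: (inj_in_map (A := mem (boxes b)) shift_box_inj); rewrite inE; apply/allP => x.
      by rewrite (perm_mem p1).
    by rewrite (perm_mem p2).
  move=> t; rewrite mem_filter linextsP; apply/and3P/mapP => [[/asboolP At pt rt]|[t' + ->]].
    have [|t' pt' et] := @perm_map_ex _ _ box0 shift_box (boxes b) t.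
      by rewrite (permPr perm_shift_boxes).
    by exists t' => //; rewrite linextsP pt'; apply/respects_shift => //; rewrite -et.
  rewrite linextsP => /andP[pt' /(respects_shift pt')[rt At]]; split=> //; first exact/asboolP.
  by rewrite -(permPr perm_shift_boxes) perm_map.
rewrite (perm_big _ pL) big_map; apply: eq_big_seq => t _; congr G.
rewrite /des size_map; apply: eq_in_filter => i; rewrite mem_iota => /andP[i0 it].
have {}it : i < size t by move: i0 it; clear; lia.
by rewrite !(nth_map box0) // (leq_ltn_trans (leq_pred i)).
Qed.

End Shift.

(** * Arrangements of the third column *)

(** The column word fixes the positions taken by column [c], and the filtered list tells which box
    of the column takes each of them. *)
Lemma index_eq_colword (t1 t2 : seq box) c r : map fst t1 = map fst t2 ->
  [seq x <- t1 | x.1 == c] = [seq x <- t2 | x.1 == c] -> index (c, r) t1 = index (c, r) t2.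
Proof.
elim: t1 t2 => [|[c1 r1] t1 IH] [|[c2 r2] t2] //= [<-] eW.
have [->|c1c] := eqVneq c1 c; first by case=> <- eF; rewrite (IH t2).
by move=> eF; rewrite !xpair_eqE (negPf c1c) /= (IH t2).
Qed.

(** Membership in [Iset], for plain natural numbers. *)
Definition shiftable (a : seq nat) (i : nat) : bool :=
  [&& i.+1 < size a, nth 0 a i == 3 & nth 0 a i.+1 != 1].

Section TripleSorted.
Variable a : seq nat.
Hypothesis peak_a : is_peak_comp a.
Hypothesis a_le3 : forall r, nth 0 a r <= 3.

Let a1 : forall r, r < size a -> 0 < nth 0 a r.
Proof. by case/is_peak_compP: peak_a. Qed.

Let a2 : forall r, r.+1 < size a -> 1 < nth 0 a r.
Proof. by case/is_peak_compP: peak_a. Qed.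

Let three r := 2 < nth 0 a r.

(** The part common to both normal forms, preserved by the exchanges in column 3 used below. *)
Definition third_bounded (t : seq box) : Prop :=
  [/\ perm_eq t (boxes a), respects box_rel t &
   forall i j, i < j -> three i -> nth 0 a j = 2 -> index (2, i) t < index (1, j) t].

Definition third_triple (t : seq box) : Prop := third_bounded t /\
  forall i j, i < j -> three i -> three j ->
    index (1, j) t < index (2, i) t -> index (2, j) t < index (2, i) t.

Definition third_sorted (t : seq box) : Prop := third_bounded t /\
  forall i j, i < j -> three i -> three j -> index (2, i) t < index (2, j) t.

Let three3 r : three r -> nth 0 a r = 3.
Proof. by rewrite /three => h; apply/eqP; rewrite eqn_leq a_le3. Qed.

Let three_lt r : three r -> r < size a.
Proof. exact: nth_pos_lt. Qed.

(** For [k] equal to 0 the premise a_j <= b_i contradicts b_i < a_j. For [k] equal to 1 and a row j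
    of length 2 the conclusion is impossible, so the premise must fail, that is, c_i < b_j; a row j
    of length 3 gives the implication in [third_triple]. *)
Lemma young_triple_tabP t : perm_eq t (boxes a) -> respects box_rel t ->
  young_triple a (tab a t) <-> third_triple t.
Proof.
move=> pt rt; have [row col] := peak_relP rt pt peak_a.
have mem x : x.1 < nth 0 a x.2 -> x \in t by rewrite (perm_mem pt) mem_boxes.
split=> [yt|[[_ _ Mt] At]].
  split.
    split=> // i j ij i3 j2; rewrite ltnNge; apply/negP => le.
    have [|||h _] := yt i j 1 ij; rewrite /diagram /= ?j2 //.
      by rewrite !entry_tab //= j2.
    by move: h; rewrite /diagram /= j2.
  move=> i j ij i3 j3 lt; have j2 : 1 < nth 0 a j by apply: ltnW.
  have [|||_] := yt i j 1 ij; rewrite /diagram /= ?entry_tab //=.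
  by rewrite ltnS ltnW.
move=> i j k ij; rewrite /diagram /= => dj di; rewrite (@entry_tab a t (k, j)) // (@entry_tab a t (k.+1, i)) //.
case: k dj di => [|[|k]] dj di.
- rewrite ltnS leqNgt => /negP; case.
  by apply: col => //; apply: nth_pos_lt dj.
- rewrite !ltnS leq_eqVlt (negPf (index_neq (mem _ _) _)) //= => lt.
  have : nth 0 a j = 2 \/ three j.
    by move: dj; rewrite leq_eqVlt /three => /predU1P[->|]; [left|right].
  case=> [j2|j3]; first by have := Mt i j ij di j2; lia.
  by split=> //; rewrite entry_tab //; apply: At.
- by have := leq_trans di (a_le3 i).
Qed.

(** The condition compares neighbouring rows only; it propagates upwards since a row of length 1 can
    only be the last one. *)
Lemma not_last_box_ltP t : perm_eq t (boxes a) -> respects box_rel t ->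
  (forall i, shiftable a i -> ~~ last_box_lt a t i)
  <-> third_sorted t.
Proof.
move=> pt rt; have [row col] := peak_relP rt pt peak_a.
have mem x : x.1 < nth 0 a x.2 -> x \in t by rewrite (perm_mem pt) mem_boxes.
split=> [h|[[_ _ Mt] Bt] i /and3P[ia i3 i1]]; last first.
  have {}i3 : three i by rewrite /three (eqP i3).
  rewrite /last_box_lt /last_box -leqNgt (three3 i3) /= ltnW //.
  have : nth 0 a i.+1 = 2 \/ three i.+1.
    by have := a1 ia; have := a_le3 i.+1; rewrite /three; case: (nth 0 a i.+1) i1 => [|[|[|[|]]]] //; [left|right].
  by case=> [j2|j3]; [rewrite j2; apply: Mt|rewrite (three3 j3); apply: Bt].
have hlast i : three i -> i.+1 < size a -> nth 0 a i.+1 != 1 -> index (2, i) t < index (last_box a i.+1) t.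
  move=> i3 ia i1; have := h i; rewrite /shiftable ia i1 (three3 i3) eqxx => /(_ isT).
  rewrite /last_box_lt /last_box (three3 i3) /= -leqNgt leq_eqVlt => /predU1P[e|//].
  have ne : (2, i) != ((nth 0 a i.+1).-1, i.+1) by rewrite xpair_eqE; lia.
  by have := index_neq (mem (2, i) i3) ne; rewrite e eqxx.
(* Induction on [j]: to pass from row j to row j+1, a row j of length 3 uses the condition again,
   and a row j of length 2 uses b_j < a_(j+1). *)
have claim i j : three i -> i < j -> 1 < nth 0 a j -> index (2, i) t < index (last_box a j) t.
  move=> i3; elim: j => // j IH ij j1; have ja := nth_pos_lt j1.
  move: ij; rewrite ltnS leq_eqVlt => /predU1P[e|ij].
    by subst j; apply: hlast => //; rewrite neq_ltn j1 orbT.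
  have j2 := a2 ja; apply: ltn_trans (IH ij j2) _.
  have [j3|j3] := boolP (three j).
    by rewrite {1}/last_box (three3 j3); apply: hlast => //; case: (nth 0 a j.+1) j1 => [|[]].
  rewrite {1}/last_box.
  have -> : (nth 0 a j).-1 = 1 by move: j3 j2; rewrite /three; lia.
  apply: leq_trans (col _ _ (ltnSn j) ja) _; rewrite /last_box.
  by apply: ltnW; apply: row; lia.
split; first split=> //.
  by move=> i j ij i3 j2; have := claim i j i3 ij; rewrite /last_box j2; apply.
by move=> i j ij i3 j3; have := claim i j i3 ij (ltnW j3); rewrite /last_box (three3 j3).
Qed.

(** * Exchanges in the third column *)

Lemma third_swap t i j : third_bounded t -> i < j -> three i -> three j ->
  index (1, j) t < index (2, i) t -> third_bounded (map (swap (2, i) (2, j)) t).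
Proof.
move=> [pt rt Mt] ij i3 j3 ji; have [row col] := peak_relP rt pt peak_a.
have ut : uniq t by rewrite (perm_uniq pt) boxes_uniq.
have mem x : x.1 < nth 0 a x.2 -> x \in t by rewrite (perm_mem pt) mem_boxes.
have pst := perm_map_swap ut (mem (2, i) i3) (mem (2, j) j3).
have ja := three_lt j3.
(* A row k of length 2 between i and j would give c_i < b_k < a_j < b_j < c_i. Hence every such row
   above i is above j, where the bound for c_j applies after the exchange. *)
have ci_bound k : i < k -> nth 0 a k = 2 -> j < k.
  move=> ik k2; have lt := Mt _ _ ik i3 k2; rewrite ltnNge leq_eqVlt.
  apply/negP => /predU1P[e|kj]; first by move: j3; rewrite /three -e k2.
  have k1 : 1 < nth 0 a j by apply: ltnW.
  have := row 0 1 j isT k1; have := col k j kj ja; lia.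
have sw2 r : swap (2, i) (2, j) (2, r) = if r == i then (2, j) else if r == j then (2, i) else (2, r).
  by rewrite /swap !xpair_eqE.
split; first exact: perm_trans pt.
  apply/respectsP => -[c r] [c' r']; rewrite !(perm_mem pst) => z1 z2 Rz; rewrite !index_map_swap.
  move/respectsP: rt => /(_ _ _ z1 z2 Rz).
  rewrite !(perm_mem pt) !mem_boxes /= in z1 z2.
  case/orP: Rz => [/eqP[? ?]|/andP[/eqP/= ? /eqP[? ?]]]; subst c' r'; last first.
    by subst c; rewrite /swap.
  have [c1|c1] := eqVneq c 1; last first.
    have c2 : c != 2 by move: (leq_trans z2 (a_le3 r)) => h; apply/eqP => e; rewrite e in h.
    by rewrite /swap !xpair_eqE (negPf c2) eqSS (negPf c1).
  subst c; rewrite [swap _ _ (1, r)]/swap /= sw2.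
  case: eqVneq => [->|ri]; last by case: eqVneq => [->|].
  move=> h; have k1 : 1 < nth 0 a j by apply: ltnW.
  have := col i j ij ja; have := row 0 1 j isT k1; have := row 1 2 j isT j3; lia.
move=> i' j' ij' i3' j2'; rewrite !index_map_swap [swap _ _ (1, _)]/swap /= sw2.
case: eqVneq => [e|ri].
  by subst i'; apply: Mt => //; apply: ci_bound.
case: eqVneq => [e|rj]; last exact: Mt.
by subst i'; apply: Mt => //; apply: ltn_trans ij'.
Qed.

(** Termination measure of the exchanges. A row without third box contributes a constant, as [index]
    then returns the length of [t]. *)
Definition third_weight (f : nat -> nat) (t : seq box) : nat :=
  \sum_(r < size a) f r * index (2, val r) t.

(** Written without subtraction: the old contributions of rows i and j are added on the left, the
    new ones on the right. *)
Lemma third_weight_swap f t i j : i < j -> j < size a ->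
  third_weight f (map (swap (2, i) (2, j)) t) + (f i * index (2, i) t + f j * index (2, j) t)
  = third_weight f t + (f i * index (2, j) t + f j * index (2, i) t).
Proof.
move=> ij ja; have ia := ltn_trans ij ja.
pose io := Ordinal ia; pose jo := Ordinal ja.
have ne : jo != io by rewrite -val_eqE /=; lia.
rewrite /third_weight !(bigD1 io isT) /= !(bigD1 jo ne) /= !index_map_swap.
have -> : \sum_(k < size a | (k != io) && (k != jo))
    f k * index (2, val k) (map (swap (2, i) (2, j)) t) =
  \sum_(k < size a | (k != io) && (k != jo)) f k * index (2, val k) t.
  apply: eq_bigr => k; rewrite -!val_eqE /= => /andP[ki kj].
  by rewrite index_map_swap /swap !xpair_eqE /= (negPf ki) (negPf kj).
rewrite /swap !xpair_eqE !eqxx /= ifN ?eqxx; last by rewrite eq_sym; lia.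
by move: (\sum_(k < size a | _) _) => A; lia.
Qed.

Lemma map_fst_swap (t : seq box) (i j : nat) : map fst (map (swap ((2, i) : box) (2, j)) t) = map fst t.
Proof.
rewrite -map_comp; apply: eq_map => x /=; rewrite /swap.
by case: eqP => [->|_] //; case: eqP => [->|].
Qed.

(** A violation is a pair i < j with b_j < c_i < c_j; exchanging c_i and c_j lowers the sum of r
    c_r. *)
Lemma third_triple_ex t : third_bounded t ->
  exists2 t', third_triple t' & map fst t' = map fst t.
Proof.
have [n] := ubnP (third_weight id t); elim: n t => // n IH t tn Mt.
have [[i [j [ij i3 j3 lt1 lt2]]]|no] := pselect (exists i j, [/\ i < j, three i, three j,
  index (1, j) t < index (2, i) t & index (2, i) t < index (2, j) t]).
  have [|t' At' et'] := IH _ _ (third_swap Mt ij i3 j3 lt1).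
    by have := third_weight_swap id t ij (three_lt j3); nia.
  by exists t' => //; rewrite et' map_fst_swap.
exists t => //; split=> // i j ij i3 j3 lt; rewrite ltnNge leq_eqVlt.
have [pt _ _] := Mt; have mem : (2, i) \in t by rewrite (perm_mem pt) mem_boxes.
have ne : index (2, i) t != index (2, j) t by apply: index_neq => //; rewrite xpair_eqE; lia.
by rewrite (negPf ne) /=; apply/negP => lt2; case: no; exists i, j.
Qed.

(** The weights [size a - r] decrease with r, so exchanging an inverted pair c_j < c_i lowers the
    measure; b_j < c_j < c_i makes the exchange legitimate. *)
Lemma third_sorted_ex t : third_bounded t ->
  exists2 t', third_sorted t' & map fst t' = map fst t.
Proof.
have [n] := ubnP (third_weight (fun r => size a - r) t); elim: n t => // n IH t tn Mt.
have [[i [j [ij i3 j3 lt]]]|no] := pselect (exists i j, [/\ i < j, three i, three j &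
  index (2, j) t < index (2, i) t]).
  have [pt rt _] := Mt; have [row col] := peak_relP rt pt peak_a.
  have [|t' At' et'] := IH _ _ (third_swap Mt ij i3 j3 (ltn_trans (row 1 2 j isT j3) lt)).
    have ja := three_lt j3.
    by have := third_weight_swap (fun r => size a - r) t ij ja; nia.
  by exists t' => //; rewrite et' map_fst_swap.
exists t => //; split=> // i j ij i3 j3; rewrite ltnNge leq_eqVlt.
have [pt _ _] := Mt; have mem : (2, j) \in t by rewrite (perm_mem pt) mem_boxes.
have ne : index (2, j) t != index (2, i) t by apply: index_neq => //; rewrite xpair_eqE; lia.
by rewrite (negPf ne) /=; apply/negP => lt2; case: no; exists i, j.
Qed.

(** * Tableaux in normal form are determined by their column words *)

Lemma filter_col t c : perm_eq t (boxes a) ->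
    (forall r r', r < r' -> c < nth 0 a r -> c < nth 0 a r' -> index (c, r) t < index (c, r') t) ->
  [seq x <- t | x.1 == c] = colbox a c.
Proof.
move=> pt inc; have ut : uniq t by rewrite (perm_uniq pt) boxes_uniq.
have tr : transitive (fun x y : box => x.2 < y.2) by move=> ? ? ?; apply: ltn_trans.
apply: (@irr_sorted_eq _ (fun x y : box => x.2 < y.2)) => //.
- by move=> x; rewrite /= ltnn.
- rewrite sorted_pairwise //.
  have pw : pairwise (fun x y => index x t < index y t) t.
    by apply/(pairwiseP box0) => i j it jt ij; rewrite !index_uniq.
  have al : all [pred x : box | (x.1 == c) && (x \in t)] [seq x <- t | x.1 == c].
    by apply/allP => x; rewrite mem_filter.
  apply: sub_in_pairwise al (pairwise_filter _ pw) => -[c1 r] [c2 r'] /andP[/= /eqP-> h] /andP[/= /eqP-> h'].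
  rewrite !(perm_mem pt) !mem_boxes /= in h h' *.
  move=> lt; rewrite ltnNge leq_eqVlt; apply/negP => /predU1P[e|/inc-/(_ h' h)]; last by lia.
  by move: lt; rewrite e ltnn.
- rewrite /colbox sorted_map; apply: sorted_filter => //; first by move=> ? ? ?; apply: ltn_trans.
  exact: iota_ltn_sorted.
- by move=> x; rewrite mem_filter mem_colbox (perm_mem pt) mem_boxes.
Qed.

Lemma third_bounded_col t c : c < 2 -> third_bounded t ->
  [seq x <- t | x.1 == c] = colbox a c.
Proof.
move=> c2 [pt rt _]; have [row col] := peak_relP rt pt peak_a.
apply: filter_col => // r r' rr' h h'; have ra := nth_pos_lt h'.
have r2 : 1 < nth 0 a r by apply: a2; apply: leq_ltn_trans ra.
case: c c2 h h' => [|[|//]] _ h h'.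
  by apply: ltn_trans (row 0 1 r isT r2) _; apply: col.
by apply: ltn_trans (col r r' rr' ra) _; apply: row.
Qed.

(** All three columns increase upwards, so the word determines the box at each position. *)
Lemma third_sorted_inj t1 t2 : third_sorted t1 -> third_sorted t2 ->
  map fst t1 = map fst t2 -> t1 = t2.
Proof.
move=> [M1 B1] [M2 B2] eW; have [p1 _ _] := M1; have [p2 _ _] := M2.
apply: eq_from_index; first by rewrite (perm_uniq p1) boxes_uniq.
  by rewrite (permPl p1) perm_sym.
move=> [c r]; rewrite (perm_mem p1) mem_boxes /= => h; apply: index_eq_colword => //.
have [c2|c2] := ltnP c 2; first by rewrite !third_bounded_col.
have -> : c = 2 by move: (leq_trans h (a_le3 r)); lia.
by rewrite (filter_col p1) ?(filter_col p2).
Qed.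

(** Columns 1 and 2 are settled as they increase upwards; column 3 is treated by downward induction
    on the row j. At the position of c_j in [s1], [s2] has some c_i. Agreement above j excludes i >
    j; if i < j then b_j < c_i, and the triple condition puts c_j earlier in [s2]. By symmetry the
    positions agree. *)
Lemma third_triple_inj t1 t2 : third_triple t1 -> third_triple t2 ->
  map fst t1 = map fst t2 -> t1 = t2.
Proof.
move=> A1 A2 eW; have [[p1 _ _] _] := A1; have [[p2 _ _] _] := A2.
apply: eq_from_index; first by rewrite (perm_uniq p1) boxes_uniq.
  by rewrite (permPl p1) perm_sym.
move=> [c r]; rewrite (perm_mem p1) mem_boxes /= => h.
have [c2|c2] := ltnP c 2.
  by case: A1 A2 => [M1 _] [M2 _]; apply: index_eq_colword => //; rewrite !third_bounded_col.
have ec : c = 2 by move: (leq_trans h (a_le3 r)); lia.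
subst c; clear c2.
have step s1 s2 j : third_triple s1 -> third_triple s2 -> map fst s1 = map fst s2 -> three j ->
    (forall i, j < i -> three i -> index (2, i) s1 = index (2, i) s2) ->
    index (2, j) s2 <= index (2, j) s1.
  move=> [M1 _] [M2 T2] eS j3 IH; have [q1 _ _] := M1; have [q2 r2 _] := M2.
  have u1 : uniq s1 by rewrite (perm_uniq q1) boxes_uniq.
  have u2 : uniq s2 by rewrite (perm_uniq q2) boxes_uniq.
  have js1 : (2, j) \in s1 by rewrite (perm_mem q1) mem_boxes.
  set v := index (2, j) s1; have v1 : v < size s1 by rewrite index_mem.
  have v2 : v < size s2 by rewrite (perm_size q2) -(perm_size q1).
  case ev : (nth box0 s2 v) => [c i].
  have cE : c = 2.
    by rewrite -[c]/((c, i).1) -ev -(nth_map _ 0) // -eS (nth_map box0) // nth_index.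
  subst c; have iv : index (2, i) s2 = v by rewrite -ev index_uniq.
  have i3 : three i.
    by have := mem_nth box0 v2; rewrite ev (perm_mem q2) mem_boxes.
  have [ij|ji|<-] := ltngtP i j; last by rewrite iv.
    apply: ltnW; rewrite -iv; apply: T2 => //; rewrite iv.
    rewrite -(@index_eq_colword s1 s2) ?third_bounded_col //.
    case: M1 => _ rs1 _; have [row _] := peak_relP rs1 q1 peak_a.
    exact: row.
  have ne : (2, j) != (2, i) by rewrite xpair_eqE; lia.
  by have := index_neq js1 ne; rewrite (IH i ji i3) iv eqxx.
have [n] := ubnP (size a - r); elim: n r h => // n IH r h rn.
have IH' i : r < i -> three i -> index (2, i) t1 = index (2, i) t2.
  by move=> ri i3; apply: IH => //; have := three_lt i3; lia.
by apply/eqP; rewrite eqn_leq !step // => i ri i3; rewrite IH'.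
Qed.

(** * Descents read off the column word *)

Definition des_colword (w : seq nat) : seq nat :=
  [seq i <- iota 1 (size w).-1 |
     (nth 0 w i < nth 0 w i.-1) || (nth 0 w i == 2) && (nth 0 w i.-1 == 2)].

(** Two consecutive entries never share column 1 or column 2, because a_r < b_r < a_r' < b_r' for r
    < r'. In column 3 the second hypothesis makes every consecutive pair a descent. *)
Lemma des_colwordP p t : third_bounded t ->
    (forall x y, x \in t -> y \in t -> index y t = (index x t).+1 -> x.1 = 2 -> y.1 = 2 ->
       if p 2 then x.2 < y.2 else y.2 < x.2) ->
  des box0 (read_key p (size a)) t = des_colword (map fst t).
Proof.
move=> [pt rt _] h2; have [row col] := peak_relP rt pt peak_a.
have ut : uniq t by rewrite (perm_uniq pt) boxes_uniq.
rewrite /des /des_colword size_map; apply: eq_in_filter => i; rewrite mem_iota => /andP[i0 it].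
have {}it : i < size t by move: i0 it; clear; case: (size t) => [|m] /=; lia.
have it' : i.-1 < size t by apply: leq_ltn_trans (leq_pred i) it.
rewrite !(nth_map box0) //; set x := nth _ _ i.-1; set y := nth _ _ i.
have xt : x \in t by rewrite mem_nth.
have yt : y \in t by rewrite mem_nth.
have exy : index y t = (index x t).+1 by rewrite !index_uniq // prednK.
have {h2} := h2 x y xt yt exy; move: xt yt exy; rewrite !(perm_mem pt) !mem_boxes.
case: x y => [c r] [c' r'] /= xb yb exy h2.
rewrite read_keyP ?(nth_pos_lt xb) ?(nth_pos_lt yb) //=.
have [e|ne] := eqVneq c' c; last first.
  by case: (eqVneq c' 2) ne => //= ->; rewrite eq_sym => /negPf ->.
subst c'; rewrite ltnn andbb /=; have [c2|c2] := eqVneq c 2.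
  by subst c; have := h2 erefl erefl; case: (p 2) => ->.
have {c2 h2} c1 : c < 2.
  by move: (leq_trans xb (a_le3 r)); rewrite ltnS leq_eqVlt (negPf c2).
exfalso; have [rr|rr|rr] := ltngtP r r'; last by move: exy; rewrite rr; clear; lia.
- have r1 : 1 < nth 0 a r by apply: a2; apply: leq_ltn_trans (nth_pos_lt yb).
  have h := col r r' rr (nth_pos_lt yb); case: c c1 xb yb exy => [|[|//]] _ xb yb exy.
    by have := row 0 1 r isT r1; move: exy h; clear; lia.
  by have := row 0 1 r' isT yb; move: exy h; clear; lia.
- have r1 : 1 < nth 0 a r' by apply: a2; apply: leq_ltn_trans (nth_pos_lt xb).
  have h := col r' r rr (nth_pos_lt xb); case: c c1 xb yb exy => [|[|//]] _ xb yb exy.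
    by have := row 0 1 r' isT r1; move: exy h; clear; lia.
  by have := row 0 1 r isT xb; move: exy h; clear; lia.
Qed.

(** If c_r' follows c_r immediately and r < r', then b_r' < c_r, and the triple condition forces
    c_r' < c_r, which is absurd. *)
Lemma des_third_triple t : third_triple t ->
  des box0 (read_key (pred1 0) (size a)) t = des_colword (map fst t).
Proof.
move=> [Mt At]; have [pt rt _] := Mt; have [row col] := peak_relP rt pt peak_a.
apply: des_colwordP => // -[c r] [c' r'] xt yt /= exy ? ?; subst c c'.
move: (xt) (yt); rewrite !(perm_mem pt) !mem_boxes /= => xb yb.
rewrite ltnNge leq_eqVlt; apply/negP => /predU1P[rr|rr].
  by move: exy; rewrite rr; clear; lia.
have ne : (2, r) != (1, r') by [].
have lt : index (1, r') t < index (2, r) t.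
  have := row 1 2 r' isT yb; rewrite exy ltnS leq_eqVlt => /predU1P[e|//].
  by have := index_neq xt ne; rewrite e eqxx.
by have := At r r' rr xb yb lt; rewrite exy ltnNge leqnSn.
Qed.

Lemma des_third_sorted t : third_sorted t ->
  des box0 (read_key (pred1 2) (size a)) t = des_colword (map fst t).
Proof.
move=> [Mt Bt]; have [pt rt _] := Mt.
apply: des_colwordP => // -[c r] [c' r'] xt yt /= exy ? ?; subst c c'.
move: (xt) (yt); rewrite !(perm_mem pt) !mem_boxes /= => xb yb.
rewrite ltnNge leq_eqVlt; apply/negP => /predU1P[rr|rr].
  by move: exy; rewrite rr; clear; lia.
by have := Bt r' r rr yb xb; rewrite exy ltnNge leqnSn.
Qed.

Lemma sum_young_triple (V : nmodType) (G : seq nat -> V) :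
  (\sum_(t <- linexts box_rel (boxes a) | `[<young_triple a (tab a t)>])
     G (des box0 (read_key (pred1 0) (size a)) t) =
   \sum_(t <- linexts box_rel (boxes a) |
         `[<forall i, shiftable a i -> ~~ last_box_lt a t i>])
     G (des box0 (read_key (pred1 2) (size a)) t))%R.
Proof.
rewrite -[LHS]big_filter -[RHS]big_filter; set LA := filter _ _; set LB := filter _ _.
have LAP t : reflect (third_triple t) (t \in LA).
  rewrite mem_filter linextsP; apply: (iffP and3P) => [[/asboolP yt pt rt]|At].
    exact/young_triple_tabP.
  have [[pt rt _] _] := At; split=> //; apply/asboolP; exact/young_triple_tabP.
have LBP t : reflect (third_sorted t) (t \in LB).
  rewrite mem_filter linextsP; apply: (iffP and3P) => [[/asboolP yt pt rt]|Bt].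
    exact/not_last_box_ltP.
  have [[pt rt _] _] := Bt; split=> //; apply/asboolP; exact/not_last_box_ltP.
(* Both sums become sums over column words; the two sets of words coincide because each normal form
   can be reached from the other by exchanges that preserve the word. *)
transitivity (\sum_(w <- map (map fst) LA) G (des_colword w))%R.
  by rewrite big_map; apply: eq_big_seq => t /LAP At; rewrite des_third_triple.
transitivity (\sum_(w <- map (map fst) LB) G (des_colword w))%R; last first.
  by rewrite big_map; apply: eq_big_seq => t /LBP Bt; rewrite des_third_sorted.
apply: perm_big; apply: uniq_perm.
- rewrite map_inj_in_uniq ?(filter_uniq _ (linexts_uniq _ _)) // => t1 t2 /LAP A1 /LAP A2.
  exact: third_triple_inj.
- rewrite map_inj_in_uniq ?(filter_uniq _ (linexts_uniq _ _)) // => t1 t2 /LBP A1 /LBP A2.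
  exact: third_sorted_inj.
- move=> w; apply/mapP/mapP => -[t ht ->].
    have /LAP[Mt _] := ht; have [t' Bt' e] := third_sorted_ex Mt.
    by exists t' => //; apply/LBP.
  have /LBP[Mt _] := ht; have [t' At' e] := third_triple_ex Mt.
  by exists t' => //; apply/LAP.
Qed.

End TripleSorted.

(** * Inclusion-exclusion *)

(** Expansion of the product of [F i + 1], with [F i] equal to -1 on [J] and 0 elsewhere; any
    element of [J] yields a zero factor. *)
Lemma sum_sign_subsets (I : finType) (J : {set I}) :
  (\sum_(S : {set I} | S \subset J) (-1) ^+ #|S| = (J == set0)%:R :> int)%R.
Proof.
pose F i : int := (if i \in J then -1 else 0)%R.
transitivity (\prod_i (F i + 1))%R.
  rewrite bigA_distr big_mkcond; apply: eq_bigr => S _; have [SJ|/subsetPn[i iS iJ]] := boolP (S \subset J).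
    rewrite -big_mkcond (eq_bigr (fun=> -1)%R) => [|i iS]; last by rewrite /F (subsetP SJ).
    by rewrite prodr_const.
  by rewrite (bigD1 i) //= iS /F (negPf iJ) mul0r.
case: eqP => [J0|/eqP/set0Pn[i iJ]].
  by rewrite big1 // => i _; rewrite /F J0 inE add0r.
by rewrite (bigD1 i) //= /F iJ addNr mul0r.
Qed.

Lemma shiftable_lt a i : shiftable a i -> i < size a.
Proof. by case/and3P=> /ltnW. Qed.

Lemma ord_pred_shiftable a (S : {set 'I_(size a)}) i :
  S \subset Iset a -> ord_pred_nat S i -> shiftable a i.
Proof. by move=> /subsetP SI /ord_pred_nat_ex[j -> /SI]; rewrite inE. Qed.

(** All terms are now sums over tableaux of the one shape [a], so the alternating sum over S can be
    evaluated tableau by tableau. *)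
Lemma Qtilde_Delta a (S : {set 'I_(size a)}) :
    is_peak_comp a -> (forall r, nth 0 a r <= 3) -> S \subset Iset a ->
  Qtilde (Delta S) =
  (\sum_(t <- linexts box_rel (boxes a) | [forall i in S, last_box_lt a t i])
     Kdes (sumn a) (des box0 (read_key (pred1 2) (size a)) t))%R.
Proof.
move=> pa a3 SI; have Pspec i : ord_pred_nat S i -> [/\ i.+1 < size a, nth 0 a i = 3 & nth 0 a i.+1 != 1].
  by move=> /(ord_pred_shiftable SI)/and3P[? /eqP].
have sD := size_Delta S; have nD k (ka : k < size a) := nth_Delta SI ka.
rewrite Qtilde_linexts; last exact: shift_peak_comp pa sD nD.
rewrite (shift_sumn pa Pspec sD nD) (sum_linexts_shift pa a3 Pspec sD nD).
apply: eq_bigl => t; apply/asboolP/forall_inP => [h i iS|h i /ord_pred_nat_ex[j -> /h//]].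
by apply: h; rewrite ord_pred_natE.
Qed.

Lemma Stilde_expansion alpha : is_peak_comp alpha -> (forall r, nth 0 alpha r <= 3) ->
  (Stilde alpha =
    \sum_(S : {set 'I_(size alpha)} | S \subset Iset alpha)
      Qtilde (Delta S) *~ ((-1) ^+ #|S|))%R.
Proof.
move=> peak_alpha a3.
rewrite Stilde_linexts // big_filter sum_young_triple //.
set F := Kdes _; pose D t := F (des box0 (read_key (pred1 2) (size alpha)) t).
(* [J t] collects the conditions violated by [t]. The sets S whose term contains [t] are the subsets
   of [J t], and their signs cancel unless [J t] is empty. *)
pose J t := [set i in Iset alpha | last_box_lt alpha t i].
transitivity (\sum_(t <- linexts box_rel (boxes alpha)) D t *~ (J t == set0)%:R)%R.
  rewrite big_mkcond; apply: eq_bigr => t _.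
  have -> : `[< forall i, shiftable alpha i -> ~~ last_box_lt alpha t i >] = (J t == set0).
    apply/asboolP/eqP => [h|Jt0 i si].
      by apply/setP => i; rewrite !inE; apply/negP => /andP[/h/negPf->].
    have ia := shiftable_lt si; apply/negP => li.
    by move/setP: Jt0 => /(_ (Ordinal ia)); rewrite !inE -/(shiftable alpha i) si li.
  by case: ifP.
transitivity (\sum_(S : {set 'I_(size alpha)} | S \subset Iset alpha)
  \sum_(t <- linexts box_rel (boxes alpha)) if S \subset J t then D t *~ ((-1) ^+ #|S|) else 0)%R; last first.
  apply: eq_bigr.
  move=> S SI; rewrite Qtilde_Delta // mulrz_suml [RHS]big_mkcond; apply: eq_bigr => t _.
  congr (if _ then _ else _); apply/subsetP/forall_inP => [h i /h|h i iS].
    by rewrite inE => /andP[].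
  by rewrite inE (subsetP SI) ?h.
rewrite exchange_big; apply: eq_bigr => t _ /=.
rewrite -sum_sign_subsets mulrz_sumr -big_mkcondr; apply: eq_bigl => S.
rewrite andb_idl // => /subset_trans; apply; apply/subsetP => i.
by rewrite inE => /andP[].
Qed.

Local Open Scope ring_scope.

Theorem proposition4p9 (alpha : seq nat)
    (peak_alpha : is_peak_comp alpha)
    (alpha_le3 : forall i : nat, (i < size alpha)%N -> (nth 0%N alpha i <= 3)%N) :
  Stilde alpha =
    \sum_(S : {set 'I_(size alpha)} | S \subset Iset alpha)
      Qtilde (Delta S) *~ ((-1) ^+ #|S|)
  /\ \sum_(S : {set 'I_(size alpha)} | S \subset Iset alpha) ((-1) ^+ #|S| : int)
     = (if Iset alpha == set0 then 1 else 0).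
Proof.
split; last by rewrite sum_sign_subsets; case: eqP.
apply: Stilde_expansion => // r.
(* Beyond the last row the default value of a part is 0. *)
by have [/alpha_le3//|ra] := ltnP r (size alpha); rewrite nth_default.
Qed.
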